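(* Let $\alpha,\beta>0$, $\gamma\in\mathbb{R}$, and for $t<0$ consider the monic orthogonal polynomials $P_n$ on $[0,1]$ for the weight $w(x;t)=(x-t)^{\gamma}x^{\alpha}(1-x)^{\beta}$, with squared norms $h_n=h_n(t)$, recurrence coefficients $\alpha_n=\alpha_n(t)$, $\beta_n=\beta_n(t)$, and let $$R_n(t):=\frac{\beta}{h_n}\int_0^1[P_n(y)]^2\,w(y;t)\,\frac{dy}{1-y}\qquad(n\ge 0).$$ Then for $n\ge1$ and $t<0$ the recurrence coefficient $\beta_n$ satisfies the first-order differential equation $$t\frac{d}{dt}\beta_n=(2+R_{n-1}-R_n)\,\beta_n .$$ Moreover, $R_n$ is related to the Painlev\'e VI equation as follows. Let $$W_n(t):=\frac{(t-1)R_n(t)}{2n+\alpha+\beta+\gamma+1}+1$$ (when the denominator $2n+\alpha+\beta+\gamma+1$ is nonzero, so that $W_n$ is defined). Then, for $t<0$, wherever the terms below are defined (that is, $W_n(t)\notin\{0,1,t\}$), $W_n$ satisfies $$W_n''=\frac12\left(\frac1{W_n}+\frac1{W_n-1}+\frac1{W_n-t}\right)(W_n')^2-\left(\frac1t+\frac1{t-1}+\frac1{W_n-t}\right)W_n'$$ $$\qquad+\frac{W_n(W_n-1)(W_n-t)}{t^2(t-1)^2}\left(\mu_1+\frac{\mu_2t}{W_n^2}+\frac{\mu_3(t-1)}{(W_n-1)^2}+\frac{\mu_4t(t-1)}{(W_n-t)^2}\right)$$ with $$\mu_1=\frac{(2n+\alpha+\beta+\gamma+1)^2}{2},\quad \mu_2=-\frac{\alpha^2}{2},\quad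 \mu_3=\frac{\beta^2}{2},\quad \mu_4=\frac{1-\gamma^2}{2}.$$
   Context: $P_n(x)=x^n+\cdots$ (depending on $t$) are the monic polynomials with $\int_0^1P_m(x)P_n(x)w(x;t)\,dx=h_n\delta_{m,n}$, $h_n>0$, $m,n\ge0$. The recurrence coefficients are defined by $xP_n(x)=P_{n+1}(x)+\alpha_nP_n(x)+\beta_nP_{n-1}(x)$ with $P_0=1$, $\beta_0P_{-1}:=0$; they depend on $t$ and are distinct from the weight parameters $\alpha,\beta$. Primes denote $d/dt$. *)

(* Defs.v *)
From HB Require Import structures.
From mathcomp Require Import all_boot all_order all_algebra.
From mathcomp Require Import all_classical all_reals all_analysis.

Set Implicit Arguments.
Unset Strict Implicit.
Unset Printing Implicit Defensive.

Import Order.TTheory GRing.Theory Num.Theory.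
Import numFieldNormedType.Exports.

Local Open Scope classical_set_scope.
Local Open Scope ring_scope.

Definition weight (R : realType) (alpha beta gamma t x : R) : R :=
  (x - t) `^ gamma * x `^ alpha * (1 - x) `^ beta.

(* [P] is the sequence of monic orthogonal polynomials on [0,1] for the
   weight [w], with squared norms [h]; [size p = n.+1] means degree [n]. *)
Definition monic_orthogonal (R : realType) (w : R -> R)
    (P : nat -> {poly R}) (h : nat -> R) : Prop :=
  [/\ forall n, P n \is monic,
      forall n, size (P n) = n.+1,
      forall n, 0 < h n
    & forall m n, \int[lebesgue_measure]_(x in `[0, 1])
        ((P m).[x] * (P n).[x] * w x) = h n * (m == n)%:R].

(* The recurrence coefficient [b 0] is not constrained: the term
   [b 0 * P_(-1)] is zero by convention. *)
Definition three_term_recurrence (R : realType) (P : nat -> {poly R})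
    (a b : nat -> R) : Prop :=
  forall n, 'X * P n =
    P n.+1 + a n *: P n + (if n is k.+1 then b n *: P k else 0).

(* At the endpoint [y = 1] the integrand takes a junk value, which does not
   affect the Lebesgue integral; for [beta > 0] the singularity there is
   integrable. *)
Definition Rn (R : realType) (alpha beta gamma : R) (P : R -> nat -> {poly R})
    (h : nat -> R -> R) (n : nat) (t : R) : R :=
  beta / h n t * \int[lebesgue_measure]_(y in `[0, 1])
    ((P t n).[y] ^+ 2 * weight alpha beta gamma t y / (1 - y)).

Definition Wn (R : realType) (alpha beta gamma : R) (P : R -> nat -> {poly R})
    (h : nat -> R -> R) (n : nat) (t : R) : R :=
  (t - 1) * Rn alpha beta gamma P h n t
    / (2 * n%:R + alpha + beta + gamma + 1) + 1.

(* [derive1] is a total operator, so the existence of the two derivatives is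
   part of the meaning of the equation. *)
Definition painleve6_at (R : realType) (mu1 mu2 mu3 mu4 : R) (W : R -> R)
    (t : R) : Prop :=
  [/\ \forall s \near t, derivable W s 1,
      derivable (derive1 W) t 1
    & derive1 (derive1 W) t =
        2^-1 * ((W t)^-1 + (W t - 1)^-1 + (W t - t)^-1) * (derive1 W t) ^+ 2
        - (t^-1 + (t - 1)^-1 + (W t - t)^-1) * derive1 W t
        + W t * (W t - 1) * (W t - t) / (t ^+ 2 * (t - 1) ^+ 2)
          * (mu1 + mu2 * t / W t ^+ 2 + mu3 * (t - 1) / (W t - 1) ^+ 2
             + mu4 * t * (t - 1) / (W t - t) ^+ 2)].

(* Main.v *)
Require Import Defs.
From HB Require Import structures.
From mathcomp Require Import all_boot all_order all_algebra.
From mathcomp Require Import all_classical all_reals all_analysis.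
From mathcomp Require Import measurable_realfun lebesgue_integral_under ring lra.

Set Implicit Arguments.
Unset Strict Implicit.
Unset Printing Implicit Defensive.

Import Order.TTheory GRing.Theory Num.Theory.
Import numFieldNormedType.Exports.

Local Open Scope classical_set_scope.
Local Open Scope ring_scope.

(** Why the theorem holds. The weight enters only through three linear
    functionals on polynomials, the integrals [L], [Lt], [L1] of [p] against
    [w], [gamma * w / (x - t)] and [beta * w / (1 - x)]. On a fixed polynomial,
    differentiation under the integral sign ([derive_power_shift_integral])
    gives [L' = - Lt] and [L1' = - (gamma * L1 + beta * Lt) / (1 - t)]; partial
    fractions relate the functionals after multiplication by [X - t] and
    [X - 1]; and integrating the derivative of [x * p * w], which vanishes at
    both endpoints, gives the Pearson relation ([jacobi_pearson]), which makes
    [L1 p - Lt p - L p'] a substitute for the integral against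
    [alpha * w / x]. The singularity of the integrand of [L1] at [1] is
    integrable because it is dominated by a derivative ([integrable01_derive]).
    What follows is algebra.

    Put [R_n = L1 (P_n ^ 2) / h_n], [S_n = Lt (P_n ^ 2) / h_n],
    [r = L1 (P_n P_(n-1)) / h_(n-1)] and [s = Lt (P_n P_(n-1)) / h_(n-1)].
    The Pearson relation gives [R_n - t S_n = kappa_n], where
    [kappa_n = 2 n + alpha + beta + gamma + 1]. Since [h_n' = - S_n h_n] and
    [beta_n = h_n / h_(n-1)], this is already the first claim.

    For the second claim, the derivative of [P_n] in [t], multiplied by
    [X - t], is a combination of [P_n] and [P_(n-1)] with coefficients [s] and
    [- beta_n S_n] ([deformation], [deformation_prev]). Hence [R_n], [r], [s]
    obey a closed first-order system, whose right-hand sides involve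
    [Xq = beta_n R_(n-1)] and [Yq = beta_n S_(n-1)]. Each of the points [1], [t]
    and [0] contributes one quadratic relation ([multiplier_quadratic]): there
    the Gram matrix of [P_n], [P_(n-1)] is expressed by the values of the two
    polynomials at that point. These are the Schlesinger equations of a linear
    system with singular points [0], [1], [t] and infinity, and [W] is the zero
    of its off-diagonal entry: [W = t (R_n - S_n) / kappa_n],
    [W - 1 = (t - 1) R_n / kappa_n], [W - t = t (t - 1) S_n / kappa_n]. So
    when [W] avoids [0], [1], [t] the auxiliary quantities can be eliminated,
    and the Painleve VI equation comes out as a multiple of the one remaining
    relation ([painleve6_algebra]). *)

(** * Derivatives of pointwise expressions *)

Section Calculus.
Variable R : realType.
Implicit Types (f g : R -> R) (t d e : R).

(** The next rules restate those of the library for functions written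
    pointwise, so that the derivative of a composite expression can be built
    as a proof term and only then compared with the expected value. *)
Lemma derive_add f g t d e : is_derive t 1 f d -> is_derive t 1 g e ->
  is_derive t 1 (fun s => f s + g s) (d + e).
Proof. by move=> hf hg; exact: is_deriveD. Qed.

Lemma derive_sub f g t d e : is_derive t 1 f d -> is_derive t 1 g e ->
  is_derive t 1 (fun s => f s - g s) (d - e).
Proof. by move=> hf hg; exact: is_deriveB. Qed.

Lemma derive_mul f g t d e : is_derive t 1 f d -> is_derive t 1 g e ->
  is_derive t 1 (fun s => f s * g s) (d * g t + f t * e).
Proof.
move=> hf hg; apply: (is_derive_eq (is_deriveM hf hg)).
by rewrite /GRing.scale/= addrC mulrC [X in _ + X]mulrC mulrC [X in X + _]mulrC.
Qed.

Lemma derive_const t c : is_derive t 1 (fun=> c : R) 0.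
Proof. exact: is_derive_cst. Qed.

Lemma derive_id t : is_derive t 1 (fun s : R => s) 1.
Proof. exact: is_derive_id. Qed.

Lemma derive_div f g t d e : is_derive t 1 f d ->
  is_derive t 1 g e -> g t != 0 ->
  is_derive t 1 (fun s => f s / g s) ((d * g t - f t * e) / g t ^+ 2).
Proof.
move=> hf hg gt0.
have hV : is_derive t 1 (fun s => (g s)^-1) (- (g t) ^- 2 * e).
  exact: is_deriveV.
apply: (is_derive_eq (derive_mul hf hV)).
by field.
Qed.

Lemma derive_powR a f t d : is_derive t 1 f d -> 0 < f t ->
  is_derive t 1 (fun s => f s `^ a) (a * f t `^ (a - 1) * d).
Proof.
move=> hf ft0.
exact: (@is_derive1_comp _ (fun z => z `^ a) f t _ _ (is_derive1_powR a ft0) hf).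
Qed.

(** The data of the problem are only constrained on the half-line of negative
    parameters, which is open: equality there is enough to transport a
    derivative. *)
Lemma derive_neg f g t d : t < 0 -> (forall s, s < 0 -> f s = g s) ->
  is_derive t 1 g d -> is_derive t 1 f d.
Proof.
move=> t0 fg hg; apply: near_eq_is_derive hg.
near=> s; apply/esym/fg; near: s; exact: lt_nbhsl.
Unshelve. all: by end_near. Qed.

Lemma derive1_val f t d : is_derive t 1 f d -> derive1 f t = d.
Proof. by move=> hf; rewrite derive1E; exact: derive_val. Qed.

End Calculus.

(** * From the Schlesinger system to Painleve VI *)

(** The Painleve VI equation as an identity of rational functions. The triple
    [(Rt, St, Rt - St)] is, up to known factors, [(W - 1, W - t, W)], so
    non-vanishing of the latter three lets [X] and [Y] be solved from the first
    two quadratic relations. What is left of the three relations is one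
    equation [C = 0], and the difference of the two sides of the Painleve
    equation is [C * 2 * Rt * St / (t * ka)]. The cofactor is read off from the
    coefficient of [r] once [s] is written through [s * Rt - r * St]: both [C]
    and the difference are then affine in [r]. *)
Lemma painleve6_algebra (R : realType) (al be ga n t Rt St r s X Y : R)
    (ka := 2 * n + al + be + ga + 1)
    (R1 := (2 * (s * Rt - r * St) - ga * Rt - be * St) / (1 - t) + St * Rt)
    (S1 := (R1 - St) / t)
    (r1 := (Y * Rt - X * St) / (1 - t))
    (s1 := r1 / t)
    (R2 := (2 * (s1 * Rt + s * R1 - (r1 * St + r * S1)) - ga * R1 - be * S1)
           / (1 - t)
         + (2 * (s * Rt - r * St) - ga * Rt - be * St) / (1 - t) ^+ 2
         + (S1 * Rt + St * R1))
    (W := (t - 1) * Rt / ka + 1)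
    (W1 := (Rt + (t - 1) * R1) / ka)
    (W2 := (2 * R1 + (t - 1) * R2) / ka) :
  t != 0 -> t - 1 != 0 -> ka != 0 -> Rt != 0 -> St != 0 -> Rt - St != 0 ->
  Rt - t * St = ka ->
  r * (r + be) = Rt * X ->
  s * (s - ga) = St * Y ->
  (r - s - n) * (r - s - n - al) = (Rt - St) * (X - Y) ->
  W2 = 2^-1 * (W^-1 + (W - 1)^-1 + (W - t)^-1) * W1 ^+ 2
       - (t^-1 + (t - 1)^-1 + (W - t)^-1) * W1
       + W * (W - 1) * (W - t) / (t ^+ 2 * (t - 1) ^+ 2)
         * (ka ^+ 2 / 2 + - (al ^+ 2 / 2) * t / W ^+ 2
            + be ^+ 2 / 2 * (t - 1) / (W - 1) ^+ 2
            + (1 - ga ^+ 2) / 2 * t * (t - 1) / (W - t) ^+ 2).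
Proof.
move=> t0 t1 ka0 R0 S0 U0 RS hX hY hC.
have t1' : 1 - t != 0 by rewrite -opprB oppr_eq0.
have eX : X = r * (r + be) / Rt by rewrite hX; field.
have eY : Y = s * (s - ga) / St by rewrite hY; field.
have W_1 : W - 1 = (t - 1) * Rt / ka by rewrite /W addrK.
have WE : W = t * (Rt - St) / ka.
  by apply: (mulIf ka0); rewrite /W mulrDl !mulfVK // mul1r -[in LHS]RS; ring.
have W_t : W - t = (t - 1) * t * St / ka.
  rewrite WE; apply: (mulIf ka0); rewrite mulrBl !mulfVK // -[in LHS]RS; ring.
(* the conic left over after elimination of X and Y *)
have C0 : r * (r + be) / Rt - s * (s - ga) / St
    - (r - s - n) * (r - s - n - al) / (Rt - St) = 0.
  by rewrite hX hY hC; field; rewrite U0 S0.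
have alE : al = Rt - t * St - 1 - 2 * n - be - ga by rewrite RS /ka; ring.
rewrite W_1 W_t WE /W2 /W1 /R2 /S1 /s1 /r1 eX eY /R1.
move: C0; rewrite -RS in ka0 *; rewrite alE.
move=> C0; apply/eqP; rewrite -subr_eq0; apply/eqP.
rewrite -[RHS](mul0r (2 * Rt * St / (t * (Rt - t * St)))) -C0.
by field; rewrite t0 t1 t1' ka0 R0 S0 U0.
Qed.

(** The first-order system satisfied by the residues of the Lax pair, in the
    form in which orthogonal polynomials provide it. Here [q] and [S] are the
    off-diagonal residues at [1] and [t], whose combination [q - t * S] is
    constant; [r] and [s] are the diagonal ones; [X] and [Y] are the residues
    in the opposite corner. The three quadratic relations fix the determinants
    of the residues at [1], [t] and [0]. *)
Lemma painleve6_of_system (R : realType) (al be ga n : R)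
    (ka := 2 * n + al + be + ga + 1) (q S r s X Y : R -> R) :
  (forall t : R, t < 0 -> q t - t * S t = ka) ->
  (forall t : R, t < 0 -> r t * (r t + be) = q t * X t) ->
  (forall t : R, t < 0 -> s t * (s t - ga) = S t * Y t) ->
  (forall t : R, t < 0 ->
    (r t - s t - n) * (r t - s t - n - al) = (q t - S t) * (X t - Y t)) ->
  (forall t : R, t < 0 -> is_derive t 1 q
     ((2 * (s t * q t - r t * S t) - ga * q t - be * S t) / (1 - t)
      + S t * q t)) ->
  (forall t : R, t < 0 ->
     is_derive t 1 r ((Y t * q t - X t * S t) / (1 - t))) ->
  (forall t : R, t < 0 ->
     is_derive t 1 s ((Y t * q t - X t * S t) / (1 - t) / t)) ->
  forall W : R -> R, (forall t : R, t < 0 -> W t = (t - 1) * q t / ka + 1) ->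
  forall t : R, ka != 0 -> t < 0 -> W t != 0 -> W t != 1 -> W t != t ->
  painleve6_at (ka ^+ 2 / 2) (- (al ^+ 2 / 2)) (be ^+ 2 / 2)
    ((1 - ga ^+ 2) / 2) W t.
Proof.
move=> hS hX hY hZ dq dr ds W hW t ka0 t0 Wn0 Wn1 Wnt.
pose f u := (2 * (s u * q u - r u * S u) - ga * q u - be * S u) / (1 - u)
            + S u * q u.
have n0 (u : R) : u < 0 -> u != 0 by move=> /lt_eqF ->.
have n1 (u : R) : u < 0 -> 1 - u != 0.
  by move=> u0; rewrite subr_eq0 gt_eqF // (lt_trans u0).
have n1' (u : R) : u < 0 -> u - 1 != 0.
  by move=> u0; rewrite subr_eq0 lt_eqF // (lt_trans u0).
have SE (u : R) : u < 0 -> S u = (q u - ka) / u.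
  by move=> u0; rewrite -(hS _ u0); field; exact: n0.
have dS (u : R) : u < 0 -> is_derive u 1 S ((f u - S u) / u).
  move=> u0; apply: (derive_neg u0 SE).
  have dN := derive_sub (dq _ u0) (derive_const u ka).
  apply: (is_derive_eq (derive_div dN (derive_id u) (n0 _ u0))).
  by rewrite -/(f u) (SE _ u0); field; exact: n0.
have dW (u : R) : u < 0 -> is_derive u 1 W ((q u + (u - 1) * f u) / ka).
  move=> u0; apply: (derive_neg u0 hW).
  have dN := derive_sub (derive_id u) (derive_const u 1).
  have dM := derive_mul (derive_mul dN (dq _ u0)) (derive_const u ka^-1).
  apply: (is_derive_eq (derive_add dM (derive_const u 1))).
  by rewrite -/(f u); ring.
have W'E (u : R) : u < 0 -> derive1 W u = (q u + (u - 1) * f u) / ka.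
  by move=> u0; exact: derive1_val (dW _ u0).
have df := derive_add
  (derive_div
    (derive_sub
      (derive_sub
        (derive_mul (derive_const t 2)
          (derive_sub (derive_mul (ds _ t0) (dq _ t0))
                      (derive_mul (dr _ t0) (dS _ t0))))
        (derive_mul (derive_const t ga) (dq _ t0)))
      (derive_mul (derive_const t be) (dS _ t0)))
    (derive_sub (derive_const t 1) (derive_id t)) (n1 _ t0))
  (derive_mul (dS _ t0) (dq _ t0)).
have dW' := derive_neg t0 W'E
  (derive_mul (derive_add (dq _ t0)
                 (derive_mul (derive_sub (derive_id t) (derive_const t 1)) df))
              (derive_const t ka^-1)).
have tne0 := n0 _ t0; have t1ne0 := n1 _ t0; have t1'ne0 := n1' _ t0.
have q0 : q t != 0.
  by apply: contra Wn1 => /eqP qt0; rewrite (hW _ t0) qt0 mulr0 mul0r add0r.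
have S0 : S t != 0.
  apply: contra Wnt => /eqP St0; rewrite (hW _ t0) -(hS _ t0) St0 mulr0 subr0.
  by rewrite mulfK // subrK.
have U0 : q t - S t != 0.
  apply: contra Wn0 => /eqP U0; rewrite (hW _ t0); apply/eqP/(mulIf ka0).
  rewrite mul0r mulrDl mulfVK // mul1r -[in LHS](hS _ t0).
  by rewrite -(mulr0 t) -U0; ring.
split.
- near=> u.
  have u0 : u < 0 by near: u; exact: lt_nbhsl.
  by case: (dW u u0).
- by case: dW'.
- rewrite (derive1_val dW') W'E //.
  have := painleve6_algebra tne0 t1'ne0 ka0 q0 S0 U0 (hS _ t0) (hX _ t0)
    (hY _ t0) (hZ _ t0).
  rewrite /= -/ka -(hW _ t0) -/(f t) => <-.
  by field; rewrite t1ne0 tne0 ka0.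
Unshelve. all: by end_near. Qed.

(** * Moment functionals and orthogonal polynomials *)

Section MomentFunctional.
Variable R : fieldType.
Implicit Types (m : nat -> R) (p q : {poly R}).

(** Integration against a weight is used only through its moments; in this form
    linearity is unconditional and differentiation in a parameter is a finite
    sum. *)
Definition moment_functional m p : R := \sum_(i < size p) p`_i * m i.

Lemma moment_functional_widen m N p : (size p <= N)%N ->
  moment_functional m p = \sum_(i < N) p`_i * m i.
Proof.
move=> pN; rewrite /moment_functional -!(big_mkord xpredT (fun i => p`_i * m i)).
rewrite [in RHS](big_cat_nat (n := size p)) //= [X in _ = _ + X]big_nat_cond.
rewrite [X in _ = _ + X]big1 ?addr0 // => i /andP[/andP[pi _] _].
by rewrite nth_default ?mul0r.
Qed.

Fact moment_functional_is_scalar m : scalar (moment_functional m).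
Proof.
move=> a p q; pose N := maxn (size p) (size q).
have pN : (size p <= N)%N by rewrite leq_maxl.
have qN : (size q <= N)%N by rewrite leq_maxr.
have apqN : (size (a *: p + q)%R <= N)%N.
  rewrite (leq_trans (size_polyD _ _)) // geq_max qN andbT.
  exact: leq_trans (size_scale_leq _ _) pN.
rewrite !(@moment_functional_widen m N) // mulr_sumr -big_split /=.
by apply: eq_bigr => i _; rewrite coefD coefZ mulrDl mulrA.
Qed.

HB.instance Definition _ m :=
  GRing.isLinear.Build R {poly R} R *%R (moment_functional m)
    (moment_functional_is_scalar m).

Lemma moment_functionalXn m k : moment_functional m 'X^k = m k.
Proof.
rewrite /moment_functional size_polyXn big_ord_recr /= coefXn eqxx mul1r.
rewrite big1 ?add0r // => i _.
by rewrite coefXn (ltn_eqF (ltn_ord i)) mul0r.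
Qed.

Lemma moment_functional_scale c a p :
  moment_functional (fun k => a * c k) p = a * moment_functional c p.
Proof. by rewrite /moment_functional mulr_sumr; apply: eq_bigr => i _; ring. Qed.

End MomentFunctional.

(** Two linear functionals on polynomials agree when they agree on monomials;
    stated for bare functions, since the functionals compared below are
    composites without a declared linear structure. *)
Lemma scalar_polyP (R : fieldType) (f g : {poly R} -> R) :
  scalar f -> scalar g -> (forall k, f 'X^k = g 'X^k) -> f =1 g.
Proof.
move=> lf lg fg.
pose F : {scalar {poly R}} := HB.pack f (GRing.isLinear.Build _ _ _ _ f lf).
pose G : {scalar {poly R}} := HB.pack g (GRing.isLinear.Build _ _ _ _ g lg).
move=> p; rewrite -[f]/(F : _ -> _) -[g]/(G : _ -> _) -[p]coefK poly_def.
by rewrite !linear_sum; apply: eq_bigr => i _; rewrite !linearZ /= fg.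
Qed.

Section OrthogonalPolynomials.
Variables (R : fieldType) (L : {scalar {poly R}}).
Variables (P : nat -> {poly R}) (h : nat -> R).
Hypothesis Pmonic : forall n, P n \is monic.
Hypothesis Psize : forall n, size (P n) = n.+1.
Hypothesis h0 : forall n, h n != 0.
Hypothesis Porth : forall m n, L (P m * P n) = h n * (m == n)%:R.

Lemma coef_lead n : (P n)`_n = 1.
Proof. by have /monicP := Pmonic n; rewrite /lead_coef Psize. Qed.

Lemma size_sub_lead n (q : {poly R}) : (size q <= n.+1)%N ->
  (size (q - q`_n *: P n)%R <= n)%N.
Proof.
move=> qn; apply/leq_sizeP => j; rewrite leq_eqVlt => /predU1P[<-|nj].
  by rewrite coefB coefZ coef_lead mulr1 subrr.
rewrite coefB coefZ [q`_j]nth_default ?(leq_trans qn) //.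
by rewrite [(P n)`_j]nth_default ?Psize // mulr0 subrr.
Qed.

Lemma orth_low n (q : {poly R}) : (size q <= n)%N -> L (P n * q) = 0.
Proof.
suff H k : forall q : {poly R}, (size q <= k)%N -> (k <= n)%N -> L (P n * q) = 0.
  by move=> qn; exact: (H n).
elim: k => [{}q|k IH {}q qk kn].
  by rewrite leqn0 size_poly_eq0 => /eqP -> _; rewrite mulr0 raddf0.
rewrite -[q](subrK (q`_k *: P k)) mulrDr linearD /= IH ?size_sub_lead ?(ltnW kn) //.
by rewrite -scalerAr linearZ /= Porth (gtn_eqF kn) !mulr0 addr0.
Qed.

Lemma orth_lead n (q : {poly R}) : (size q <= n.+1)%N ->
  L (P n * q) = q`_n * h n.
Proof.
move=> qn; rewrite -{1}[q](subrK (q`_n *: P n)) mulrDr linearD /=.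
by rewrite orth_low ?size_sub_lead // add0r -scalerAr linearZ /= Porth eqxx mulr1.
Qed.

(** Orthogonality to the first [N] members of the family is how polynomial
    identities in degree less than [N] are proved below. *)
Lemma orth_complete N (q : {poly R}) : (size q <= N)%N ->
  (forall k, (k < N)%N -> L (q * P k) = 0) -> q = 0.
Proof.
move=> qN Hq; apply/eqP/negP => /negP q0.
have sq : (0 < size q)%N by rewrite size_poly_gt0.
have := Hq (size q).-1; rewrite prednK // => /(_ qN).
rewrite mulrC orth_lead ?prednK // => /eqP; rewrite mulf_eq0 (negbTE (h0 _)) orbF.
by rewrite -/(lead_coef q) lead_coef_eq0 (negbTE q0).
Qed.

(** Three-term structure: the part of [X P_k] of degree at most [k]. *)
(** The leading terms of [(X - c) P_k] and [P_(k+1)] cancel. *)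
Lemma size_lead_step k (c : R) :
  (size (('X - c%:P) * P k - P k.+1)%R <= k.+1)%N.
Proof.
apply/leq_sizeP => -[//|i] ki; rewrite coefB mulrBl coefB coefXM mul_polyC coefZ.
rewrite [(P k)`_i.+1]nth_default ?Psize // mulr0 subr0 /=.
move: ki; rewrite ltnS leq_eqVlt => /predU1P[<-|ki].
  by rewrite !coef_lead subrr.
by rewrite !nth_default ?Psize ?subrr.
Qed.

(** A functional [M] that becomes a multiple of [L] after multiplication by
    [X - e], as does integration against the weight divided by [x - e]. *)
Section Multiplier.
Variables (M : {scalar {poly R}}) (e g : R).
Hypothesis HM : forall p, M (('X - e%:P) * p) = g * L p.

(** [F - F(e)] is [X - e] times a polynomial of lower degree, which is
    orthogonal to [P_n]. *)
Lemma multiplier_eval n (F : {poly R}) : (size F <= n.+1)%N ->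
  M (P n * F) = F.[e] * M (P n).
Proof.
move=> Fn; have /factor_theorem[Q FQ] : root (F - F.[e]%:P) e.
  by rewrite /root !hornerE subrr.
have Qn : (size Q <= n)%N.
  have [->|Q0] := eqVneq Q 0; first by rewrite size_poly0.
  have := size_mul Q0 (negbT (polyXsubC_eq0 e)).
  rewrite -FQ size_XsubC addn2 => /= sQ; rewrite -ltnS -sQ.
  rewrite (leq_trans (size_polyD _ _)) // geq_max Fn size_polyN.
  by rewrite (leq_trans (size_polyC_leq1 _)).
rewrite -[F in LHS](subrK F.[e]%:P) FQ mulrDr linearD /=.
rewrite mulrA [_ * ('X - _)]mulrC HM orth_low // mulr0 add0r.
by rewrite mulrC mul_polyC linearZ.
Qed.

(** By [multiplier_eval] the three values of [M] on products of [P_(k+1)] and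
    [P_k] are products of point values at [e] and of [M P_(k+1)], [M P_k]; the
    mixed one can be evaluated in two ways, which differ by [g * h k]. This is
    the determinant of the residue at [e] of the associated linear system. *)
Lemma multiplier_quadratic k :
  M (P k.+1 * P k.+1) * M (P k * P k) =
  M (P k.+1 * P k) * (M (P k.+1 * P k) - g * h k).
Proof.
have e1 : M (P k.+1 * P k.+1) = (P k.+1).[e] * M (P k.+1).
  by rewrite multiplier_eval ?Psize.
have e2 : M (P k.+1 * P k) = (P k).[e] * M (P k.+1).
  by rewrite multiplier_eval ?Psize.
have e3 : M (P k * P k) = (P k).[e] * M (P k) by rewrite multiplier_eval ?Psize.
have e4 : M (P k.+1 * P k) = (P k.+1).[e] * M (P k) + g * h k.
  have sF : (size (P k.+1 - ('X - e%:P) * P k)%R <= k.+1)%N.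
    by rewrite -opprB size_polyN size_lead_step.
  rewrite -[P k.+1 in LHS](subrK (('X - e%:P) * P k)) mulrDl linearD /=.
  rewrite [_ * P k in X in X + _]mulrC (multiplier_eval sF) -mulrA HM.
  by rewrite Porth eqxx mulr1 !hornerE subrr mul0r subr0.
by rewrite {2}e4 addrK e1 e3 e2; ring.
Qed.

End Multiplier.
End OrthogonalPolynomials.

(** * Semiclassical relations and deformation at a fixed parameter *)

(** At a fixed parameter [t], [L], [Lt] and [L1] stand for the integrals of [p]
    against [w], [ga * w / (x - t)] and [be * w / (1 - x)]. The Pearson
    hypothesis is the vanishing of the integral of the derivative of
    [x * p * w]. *)
Section SemiClassical.
Variables (R : fieldType) (al be ga t : R).
Variables L Lt L1 : {scalar {poly R}}.
Hypothesis Lt_mul : forall p, Lt (('X - t%:P) * p) = ga * L p.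
Hypothesis L1_mul : forall p, L1 (('X - 1%:P) * p) = - be * L p.
Hypothesis pearson :
  forall p, L1 ('X * p) - Lt ('X * p) - L ('X * p)^`() = al * L p.

Variables (P : nat -> {poly R}) (h : nat -> R).
Hypothesis Pmonic : forall n, P n \is monic.
Hypothesis Psize : forall n, size (P n) = n.+1.
Hypothesis h0 : forall n, h n != 0.
Hypothesis Porth : forall m n, L (P m * P n) = h n * (m == n)%:R.

Let Pdiag n : L (P n * P n) = h n. Proof. by rewrite Porth eqxx mulr1. Qed.
Let Plow n := orth_low Pmonic Psize Porth (n := n).
Let Plead n := orth_lead Pmonic Psize Porth (n := n).
Let Pcoef := coef_lead Pmonic Psize.

Let PSk k : L (P k.+1 * P k) = 0.
Proof. by rewrite Plow ?Psize. Qed.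

Let size_deriv n : (size (P n)^`() <= n)%N.
Proof. by rewrite -ltnS -[n.+1]Psize lt_size_deriv // -size_poly_gt0 Psize. Qed.

Let size_Xderiv n : (size ('X * (P n)^`())%R <= n.+1)%N.
Proof.
by rewrite (leq_trans (size_polyMleq _ _)) // size_polyX ltnS size_deriv.
Qed.

Let coef_Xderiv n i : ('X * (P n)^`())`_i = (P n)`_i *+ i.
Proof. by rewrite coefXM; case: i => [|i] /=; rewrite ?mulr0n ?coef_deriv. Qed.

Let Lt_X p : Lt ('X * p) = t * Lt p + ga * L p.
Proof.
by rewrite -Lt_mul mulrBl mul_polyC linearB linearZ /= addrC subrK.
Qed.

Let L1_X p : L1 ('X * p) = L1 p - be * L p.
Proof. by rewrite -mulNr -L1_mul mulrBl mul1r linearB /= addrC subrK. Qed.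

(** The Pearson relation at [P_n ^ 2]: the derivative of [X P_n ^ 2] only
    contributes through the leading coefficient [n] of [X P_n']. *)
Lemma semiclassical_diag n :
  L1 (P n * P n) - t * Lt (P n * P n) =
  (2 * n%:R + al + be + ga + 1) * h n.
Proof.
have := pearson (P n * P n); rewrite Lt_X L1_X !derivM derivX.
have -> : 1 * (P n * P n) + 'X * ((P n)^`() * P n + P n * (P n)^`())
    = P n * (P n + 2%:R *: ('X * (P n)^`())).
  by rewrite scaler_nat; ring.
rewrite mulrDr -scalerAr linearD linearZ /= (Plead (size_Xderiv n)).
rewrite coef_Xderiv Pcoef Pdiag => e.
have -> : L1 (P n * P n) - t * Lt (P n * P n) =
  (L1 (P n * P n) - be * h n - (t * Lt (P n * P n) + ga * h n)
   - (h n + 2 * (n%:R * h n))) + (be + ga + 1 + 2 * n%:R) * h n by ring.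
by rewrite e; ring.
Qed.

(** The Pearson relation at [P_(k+1) P_k]. The combination
    [X P' - (k + 1) P] for [P = P_(k+1)] loses its leading term, and its next
    coefficient is minus the subleading coefficient of [P_(k+1)]. *)
Lemma semiclassical_offdiag k :
  L1 (P k.+1 * P k) - t * Lt (P k.+1 * P k) = - (P k.+1)`_k * h k.
Proof.
have := pearson (P k.+1 * P k); rewrite Lt_X L1_X !derivM derivX.
have -> : 1 * (P k.+1 * P k) + 'X * ((P k.+1)^`() * P k + P k.+1 * (P k)^`())
    = P k * ('X * (P k.+1)^`() - k.+1%:R *: P k.+1)
      + P k.+1 * ((k.+1%:R + 1) *: P k + 'X * (P k)^`()).
  by rewrite -!mul_polyC rmorphD /=; ring.
have sz : (size ('X * (P k.+1)^`() - k.+1%:R *: P k.+1)%R <= k.+1)%N.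
  apply/leq_sizeP => j kj; rewrite coefB coef_Xderiv coefZ mulr_natl.
  move: kj; rewrite leq_eqVlt => /predU1P[<-|kj]; first by rewrite subrr.
  by rewrite [(P k.+1)`_j]nth_default ?Psize // !mul0rn subrr.
rewrite PSk linearD /= (Plead sz) coefB coef_Xderiv coefZ Plow; last first.
  rewrite (leq_trans (size_polyD _ _)) // geq_max size_Xderiv andbT.
  by rewrite (leq_trans (size_scale_leq _ _)) ?Psize.
move=> e.
have -> : L1 (P k.+1 * P k) - t * Lt (P k.+1 * P k) =
  L1 (P k.+1 * P k) - be * 0 - (t * Lt (P k.+1 * P k) + ga * 0)
  - (((P k.+1)`_k *+ k - k.+1%:R * (P k.+1)`_k) * h k + 0)
  + ((P k.+1)`_k *+ k - k.+1%:R * (P k.+1)`_k) * h k by ring.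
by rewrite e -mulr_natl -natr1; ring.
Qed.

Lemma quadratic_at_t k :
  Lt (P k.+1 * P k.+1) * Lt (P k * P k) =
  Lt (P k.+1 * P k) * (Lt (P k.+1 * P k) - ga * h k).
Proof. exact: (multiplier_quadratic Pmonic Psize Porth Lt_mul). Qed.

Lemma quadratic_at_1 k :
  L1 (P k.+1 * P k.+1) * L1 (P k * P k) =
  L1 (P k.+1 * P k) * (L1 (P k.+1 * P k) + be * h k).
Proof.
by rewrite (multiplier_quadratic Pmonic Psize Porth L1_mul) mulNr opprK.
Qed.

(** The functional [p |-> L1 p - Lt p - L p'] plays the part of
    [al * w / x]: by the Pearson relation it is a multiplier at [0], and this
    avoids a third singular integral. *)
Lemma quadratic_at_0 k (U := fun n => L1 (P n * P n) - Lt (P n * P n))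
    (u := L1 (P k.+1 * P k) - Lt (P k.+1 * P k) - k.+1%:R * h k) :
  U k.+1 * U k = u * (u - al * h k).
Proof.
pose f p := L1 p - Lt p - L p^`().
have lf : scalar f.
  by move=> a p q; rewrite /f derivD derivZ !linearP /=; ring.
pose L0 : {scalar {poly R}} := HB.pack f (GRing.isLinear.Build _ _ _ _ f lf).
have HL0 p : L0 (('X - 0%:P) * p) = al * L p by rewrite subr0; exact: pearson.
have eU n : L0 (P n * P n) = U n.
  rewrite /L0 /= /f.
  have -> : (P n * P n)^`() = 2%:R *: (P n * (P n)^`()).
    by rewrite derivM scaler_nat; ring.
  by rewrite linearZ /= Plow ?size_deriv // mulr0 subr0.
have eu : L0 (P k.+1 * P k) = u.
  rewrite /L0 /= /f derivM linearD /= [L (P k.+1 * _^`())]Plow; last first.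
    by rewrite (leq_trans (size_deriv k)).
  by rewrite addr0 [_^`() * _]mulrC (Plead (size_deriv _)) coef_deriv Pcoef.
have := multiplier_quadratic Pmonic Psize Porth HL0 k.
by rewrite !eU eu.
Qed.

(** [D n] stands for the derivative of [P_n] in the parameter. As [P_n] is
    monic the degree drops, and [DL] is the derivative of the orthogonality
    relations. *)
Section Deformation.
Variable D : nat -> {poly R}.
Hypothesis Dsize : forall n, (size (D n) <= n)%N.
Hypothesis DL : forall n (q : {poly R}), (size q <= n)%N ->
  L (D n * q) = Lt (P n * q).

Let size_XP c k : (size (('X - c%:P) * P k)%R <= k.+2)%N.
Proof.
by rewrite (leq_trans (size_polyMleq _ _)) // size_XsubC Psize.
Qed.

Let Dlow n : L (P n * D n) = 0. Proof. exact: Plow. Qed.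

(** [(X - t) D_(k+1)] is a combination of [P_(k+1)] and [P_k] only: tested
    against [P_j] with [j < k], the factor [X - t] moves to [P_j] and turns
    [Lt] into [L]. *)
Lemma deformation k :
  ('X - t%:P) * D k.+1 =
  (Lt (P k.+1 * P k) / h k) *: P k.+1
  - (Lt (P k.+1 * P k.+1) / h k) *: P k.
Proof.
apply/eqP; rewrite -subr_eq0; apply/eqP.
set E := (X in X = 0).
have EE q : L (E * q) = L (D k.+1 * (('X - t%:P) * q))
   - (Lt (P k.+1 * P k) / h k * L (P k.+1 * q)
      - Lt (P k.+1 * P k.+1) / h k * L (P k * q)).
  have -> : E * q = D k.+1 * (('X - t%:P) * q)
    - (Lt (P k.+1 * P k) / h k *: (P k.+1 * q)
       - Lt (P k.+1 * P k.+1) / h k *: (P k * q)).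
    by rewrite /E -!mul_polyC; ring.
  by rewrite !linearB !linearZ.
have sE : (size E <= k.+2)%N.
  rewrite (leq_trans (size_polyD _ _)) // geq_max size_polyN.
  rewrite (leq_trans (size_polyMleq _ _)) /=; last first.
    by rewrite size_XsubC add2n /= !ltnS Dsize.
  rewrite (leq_trans (size_polyD _ _)) // geq_max size_polyN.
  by rewrite !(leq_trans (size_scale_leq _ _)) ?Psize.
apply: (orth_complete Pmonic Psize h0 Porth sE) => j.
rewrite !ltnS EE !Porth.
rewrite leq_eqVlt => /predU1P[->|].
  (* test against the top polynomial: only the leading coefficient of D *)
  have sXD : (size (('X - t%:P) * D k.+1)%R <= k.+2)%N.
    rewrite (leq_trans (size_polyMleq _ _)) // size_XsubC add2n /=.
    by rewrite !ltnS Dsize.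
  rewrite (ltn_eqF (ltnSn k)) eqxx !mulr0 subr0 mulr1.
  rewrite [L _](_ : _ = L (P k.+1 * (('X - t%:P) * D k.+1))); last first.
    by congr (L _); ring.
  rewrite (Plead sXD) mulrBl coefB coefXM mul_polyC coefZ /=.
  rewrite [(D k.+1)`_k.+1]nth_default ?Dsize // mulr0 subr0.
  have := Plead (Dsize k.+1); rewrite mulrC DL ?Psize // => ->.
  by rewrite mulfK ?h0 // subrr.
rewrite ltnS leq_eqVlt => /predU1P[->|jk].
  rewrite (gtn_eqF (ltnSn k)) eqxx !mulr0 mulr1 sub0r.
  rewrite mulfVK ?h0 // opprK.
  rewrite -[('X - t%:P) * P k](subrK (P k.+1)) mulrDr linearD /=.
  rewrite (DL (size_lead_step Pmonic Psize k t)) [D _ * _]mulrC Dlow addr0.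
  rewrite mulrBr linearB /= mulrCA Lt_mul PSk mulr0 sub0r.
  by rewrite addNr.
have jk1 : (j < k.+1)%N by rewrite ltnW.
rewrite (gtn_eqF jk) (gtn_eqF jk1) !mulr0 !subr0.
rewrite DL ?(leq_trans (size_XP _ _)) // mulrCA Lt_mul.
by rewrite Porth (gtn_eqF jk1) !mulr0.
Qed.

(** The lower equation of the same system. [D_k + S_k P_k], with [S_k] the
    coefficient shown, is [h_k] times the derivative of [P_k / h_k]; unlike
    [D_k] it represents [Lt (P_k * q)] for all [q] of degree at most [k]. *)
Lemma deformation_prev k :
  ('X - t%:P) * (D k + (Lt (P k * P k) / h k) *: P k) =
  (Lt (P k * P k) / h k) *: P k.+1
  - (Lt (P k.+1 * P k) / h k - ga) *: P k.
Proof.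
apply/eqP; rewrite -subr_eq0; apply/eqP.
set Dt := D k + _; set E := (X in X = 0).
have sDt : (size Dt <= k.+1)%N.
  rewrite (leq_trans (size_polyD _ _)) // geq_max.
  by rewrite (leq_trans (Dsize _)) // (leq_trans (size_scale_leq _ _)) ?Psize.
have DtL (q : {poly R}) : (size q <= k.+1)%N -> L (Dt * q) = Lt (P k * q).
  move=> sq; have DtE p :
      L (Dt * p) = L (D k * p) + Lt (P k * P k) / h k * L (P k * p).
    by rewrite /Dt mulrDl -scalerAl linearD linearZ.
  have : (size (q - q`_k *: P k)%R <= k)%N by exact: size_sub_lead.
  move: (q`_k) (subrK (q`_k *: P k) q) => c; move: (q - _) => q' <- sq'.
  rewrite !mulrDr !linearD /= -!scalerAr !linearZ /= !DtE DL // Plow //.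
  by rewrite [D k * P k]mulrC Dlow Pdiag mulfVK // mulr0 addr0 add0r.
have EE q : L (E * q) = L (Dt * (('X - t%:P) * q))
   - (Lt (P k * P k) / h k * L (P k.+1 * q)
      - (Lt (P k.+1 * P k) / h k - ga) * L (P k * q)).
  have -> : E * q = Dt * (('X - t%:P) * q)
    - (Lt (P k * P k) / h k *: (P k.+1 * q)
       - (Lt (P k.+1 * P k) / h k - ga) *: (P k * q)).
    by rewrite /E -!mul_polyC; ring.
  by rewrite !linearB !linearZ.
have sE : (size E <= k.+1)%N.
  have -> : E = D k * ('X - t%:P)
      + (Lt (P k * P k) / h k) *: (('X - t%:P) * P k - P k.+1)
      + (Lt (P k.+1 * P k) / h k - ga) *: P k.
    by rewrite /E /Dt -!mul_polyC; ring.
  rewrite (leq_trans (size_polyD _ _)) // geq_max.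
  rewrite (leq_trans (size_polyD _ _)) /= ?geq_max.
    by rewrite (leq_trans (size_scale_leq _ _)) ?Psize.
  rewrite (leq_trans (size_polyMleq _ _)) /=; last first.
    by rewrite size_XsubC addn2 /= ltnS Dsize.
  by rewrite (leq_trans (size_scale_leq _ _)) ?size_lead_step.
apply: (orth_complete Pmonic Psize h0 Porth sE) => j jk.
rewrite EE !Porth (gtn_eqF jk) !mulr0 sub0r opprK.
move: jk; rewrite ltnS leq_eqVlt => /predU1P[->|jk].
  rewrite eqxx mulr1 -[('X - t%:P) * P k](subrK (P k.+1)) mulrDr linearD /=.
  rewrite (DtL _ (size_lead_step Pmonic Psize k t)) [Dt * _]mulrC Plow // addr0.
  rewrite mulrBr linearB /= mulrCA Lt_mul Pdiag mulrBl mulfVK //.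
  by rewrite [P k * _]mulrC; ring.
rewrite (gtn_eqF jk) !mulr0 addr0 DtL ?(leq_trans (size_XP _ _)) //.
by rewrite mulrCA Lt_mul Porth (gtn_eqF jk) !mulr0.
Qed.

(** [1 - t] is [X - t] minus [X - 1]: the first factor is the one that the
    deformation equations determine, the second removes the pole of [L1]. *)
Let L1_split (p q : {poly R}) :
  (1 - t) * L1 (p * q) = L1 (p * (('X - t%:P) * q)) + be * L (p * q).
Proof.
have -> : p * (('X - t%:P) * q) = (1 - t) *: (p * q) + ('X - 1%:P) * (p * q).
  by rewrite -mul_polyC rmorphB; ring.
by rewrite linearD linearZ /= L1_mul; ring.
Qed.

Lemma L1_deform_diag k :
  (1 - t) * L1 (P k.+1 * D k.+1) =
  Lt (P k.+1 * P k) / h k * L1 (P k.+1 * P k.+1)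
  - Lt (P k.+1 * P k.+1) / h k * L1 (P k.+1 * P k).
Proof.
rewrite L1_split Dlow mulr0 addr0 deformation mulrBr -!scalerAr.
by rewrite linearB !linearZ.
Qed.

Lemma L1_deform_left k :
  (1 - t) * L1 (D k.+1 * P k) =
  Lt (P k.+1 * P k) / h k * L1 (P k.+1 * P k)
  - Lt (P k.+1 * P k.+1) / h k * L1 (P k * P k)
  + be * Lt (P k.+1 * P k).
Proof.
rewrite mulrC [D _ * _]mulrC mulrC L1_split deformation mulrBr -!scalerAr.
rewrite [P k * P k.+1]mulrC [P k * D _]mulrC DL ?Psize //.
by rewrite linearB !linearZ.
Qed.

Lemma L1_deform_right k :
  (1 - t) * L1 (P k.+1 * (D k + (Lt (P k * P k) / h k) *: P k)) =
  Lt (P k * P k) / h k * L1 (P k.+1 * P k.+1)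
  - (Lt (P k.+1 * P k) / h k - ga) * L1 (P k.+1 * P k).
Proof.
rewrite L1_split deformation_prev mulrBr -!scalerAr Plow ?mulr0 ?addr0.
  by rewrite linearB !linearZ.
rewrite (leq_trans (size_polyD _ _)) // geq_max.
by rewrite (leq_trans (Dsize _)) // (leq_trans (size_scale_leq _ _)) ?Psize.
Qed.

End Deformation.
End SemiClassical.

(** * Evolution in the parameter *)

Section PolynomialFamilies.
Variable R : realType.
Implicit Types (p q : R -> {poly R}) (d e : {poly R}) (t : R).

Lemma derive_sum n (F : nat -> R -> R) (dF : nat -> R) t :
  (forall i, is_derive t 1 (F i) (dF i)) ->
  is_derive t 1 (fun s => \sum_(i < n) F i s) (\sum_(i < n) dF i).
Proof.
move=> hF; elim: n => [|n IH].
  rewrite big_ord0 (_ : (fun _ => _) = fun=> 0); first exact: derive_const.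
  by apply/funext => s; rewrite big_ord0.
rewrite big_ord_recr /=.
rewrite (_ : (fun _ => _) = fun s => \sum_(i < n) F i s + F n s).
  exact: derive_add.
by apply/funext => s; rewrite big_ord_recr.
Qed.

Definition coef_derive t p d :=
  forall i, is_derive t 1 (fun s => (p s)`_i) d`_i.

Lemma coef_derive_const t d : coef_derive t (fun=> d) 0.
Proof. by move=> i; rewrite coef0; exact: derive_const. Qed.

Lemma coef_derive_sub t p q d e : coef_derive t p d -> coef_derive t q e ->
  coef_derive t (fun s => p s - q s) (d - e).
Proof.
move=> hp hq i; rewrite coefB.
rewrite (_ : (fun _ => _) = fun s => (p s)`_i - (q s)`_i).
  exact: derive_sub.
by apply/funext => s; rewrite coefB.
Qed.

Lemma coef_derive_mul t p q d e : coef_derive t p d -> coef_derive t q e ->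
  coef_derive t (fun s => p s * q s) (d * q t + p t * e).
Proof.
move=> hp hq i; rewrite coefD !coefM -big_split /=.
rewrite (_ : (fun _ => _) = fun s => \sum_(j < i.+1) (p s)`_j * (q s)`_(i - j)).
  apply: (derive_sum i.+1 (F := fun j s => (p s)`_j * (q s)`_(i - j))
    (dF := fun j => d`_j * (q t)`_(i - j) + (p t)`_j * e`_(i - j))) => j.
  exact: derive_mul.
by apply/funext => s; rewrite coefM.
Qed.

Lemma coef_derive_scale t (f : R -> R) p c d : is_derive t 1 f c ->
  coef_derive t p d ->
  coef_derive t (fun s => f s *: p s) (c *: p t + f t *: d).
Proof.
move=> hf hp i; rewrite coefD !coefZ.
rewrite (_ : (fun _ => _) = fun s => f s * (p s)`_i); first exact: derive_mul.
by apply/funext => s; rewrite coefZ.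
Qed.

Lemma coef_derive_neg t p q d : t < 0 -> (forall s, s < 0 -> p s = q s) ->
  coef_derive t q d -> coef_derive t p d.
Proof.
move=> t0 pq hq i; apply: (derive_neg t0 _ (hq i)) => s s0.
by rewrite pq.
Qed.

Lemma coef_derive_size t p d N : t < 0 ->
  (forall s, s < 0 -> (size (p s) <= N)%N) -> coef_derive t p d ->
  (size d <= N)%N.
Proof.
move=> t0 pN hd; apply/leq_sizeP => j Nj; rewrite -(derive1_val (hd j)).
apply: derive1_val; apply: (derive_neg t0 _ (derive_const t 0)) => s s0.
by rewrite nth_default // (leq_trans (pN _ s0)).
Qed.

(** The uniform bound on the degrees turns the functional into a sum with a
    fixed number of terms. *)
Lemma derive_moment_functional (m : nat -> R -> R) (dm : nat -> R) p d t N :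
  t < 0 -> (forall s, s < 0 -> (size (p s) <= N)%N) ->
  (forall k, is_derive t 1 (m k) (dm k)) -> coef_derive t p d ->
  is_derive t 1 (fun s => moment_functional (m ^~ s) (p s))
    (moment_functional dm (p t) + moment_functional (m ^~ t) d).
Proof.
move=> t0 pN hm hp; have dN := coef_derive_size t0 pN hp.
rewrite (moment_functional_widen _ dN) (moment_functional_widen _ (pN _ t0)).
rewrite -big_split /=.
apply: (derive_neg t0 (g := fun s => \sum_(i < N) (p s)`_i * m i s)).
  by move=> s s0; rewrite (moment_functional_widen _ (pN _ s0)).
apply: (derive_sum N (F := fun i s => (p s)`_i * m i s)
  (dF := fun i => (p t)`_i * dm i + d`_i * m i t)) => i.
apply: (is_derive_eq (derive_mul (hp i) (hm i))).
by rewrite addrC.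
Qed.

Lemma moment_functional_comb (m m' : nat -> R) (a b : R) (p : {poly R}) :
  moment_functional (fun k => a * m k + b * m' k) p =
  a * moment_functional m p + b * moment_functional m' p.
Proof.
rewrite /moment_functional !mulr_sumr -big_split /=.
by apply: eq_bigr => i _; ring.
Qed.

End PolynomialFamilies.

(** The hypotheses on the moments [m], [mt], [m1] are what the weight provides:
    two partial fraction identities, the Pearson relation, and the derivatives
    of the moments in the parameter. *)
Section Evolution.
Variables (R : realType) (al be ga : R) (m mt m1 : nat -> R -> R).
Hypothesis mt_step : forall (t : R) k, t < 0 ->
  mt k.+1 t = t * mt k t + ga * m k t.
Hypothesis m1_step : forall (t : R) k, t < 0 -> m1 k.+1 t = m1 k t - be * m k t.
Hypothesis pearson_step : forall (t : R) k, t < 0 ->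
  m1 k.+1 t - mt k.+1 t = (k.+1%:R + al) * m k t.
Hypothesis derive_m : forall (t : R) k, t < 0 -> is_derive t 1 (m k) (- mt k t).
Hypothesis derive_m1 : forall (t : R) k, t < 0 ->
  is_derive t 1 (m1 k) (- (ga * m1 k t + be * mt k t) / (1 - t)).

Local Notation L t := (moment_functional (m ^~ t)).
Local Notation Lt t := (moment_functional (mt ^~ t)).
Local Notation L1 t := (moment_functional (m1 ^~ t)).

Variables (P : R -> nat -> {poly R}) (h a b : nat -> R -> R).
Hypothesis Pmonic : forall (t : R) n, t < 0 -> P t n \is monic.
Hypothesis Psize : forall (t : R) n, t < 0 -> size (P t n) = n.+1.
Hypothesis h_gt0 : forall (t : R) n, t < 0 -> 0 < h n t.
Hypothesis Porth : forall (t : R) i j, t < 0 ->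
  L t (P t i * P t j) = h i t * (i == j)%:R.
Hypothesis Prec : forall t : R, t < 0 ->
  three_term_recurrence (P t) (fun n => a n t) (fun n => b n t).

Let h0 (t : R) n : t < 0 -> h n t != 0.
Proof. by move=> t0; rewrite gt_eqF ?h_gt0. Qed.

Let Porth' (t : R) i j : t < 0 -> L t (P t i * P t j) = h j t * (i == j)%:R.
Proof. by move=> t0; rewrite mulrC Porth // eq_sym. Qed.

Let Lt_mul (t : R) p : t < 0 -> Lt t (('X - t%:P) * p) = ga * L t p.
Proof.
move=> t0.
apply: (scalar_polyP (f := fun p => Lt t (('X - t%:P) * p))
                     (g := fun p => ga * L t p)).
- by move=> c u v; rewrite mulrDr -scalerAr linearD linearZ.
- by move=> c u v; rewrite linearD linearZ /=; ring.
- move=> k; rewrite mulrBl -exprS mul_polyC linearB linearZ /=.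
  by rewrite !moment_functionalXn mt_step //; ring.
Qed.

Let L1_mul (t : R) p : t < 0 -> L1 t (('X - 1%:P) * p) = - be * L t p.
Proof.
move=> t0.
apply: (scalar_polyP (f := fun p => L1 t (('X - 1%:P) * p))
                     (g := fun p => - be * L t p)).
- by move=> c u v; rewrite mulrDr -scalerAr linearD linearZ.
- by move=> c u v; rewrite linearD linearZ /=; ring.
- move=> k; rewrite mulrBl -exprS mul1r linearB /=.
  by rewrite !moment_functionalXn m1_step //; ring.
Qed.

Let pearson (t : R) p : t < 0 ->
  L1 t ('X * p) - Lt t ('X * p) - L t ('X * p)^`() = al * L t p.
Proof.
move=> t0.
apply: (scalar_polyP
  (f := fun p => L1 t ('X * p) - Lt t ('X * p) - L t ('X * p)^`())
  (g := fun p => al * L t p)).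
- move=> c u v; rewrite mulrDr -scalerAr derivD derivZ !linearP /=.
  by rewrite /GRing.scale /=; ring.
- by move=> c u v; rewrite linearD linearZ /=; ring.
- move=> k; rewrite -exprS derivXn linearMn /=.
  by rewrite !moment_functionalXn pearson_step //= -[_ *+ k.+1]mulr_natl; ring.
Qed.

Let h_diag (t : R) n : t < 0 -> h n t = L t (P t n * P t n).
Proof. by move=> t0; rewrite Porth // eqxx mulr1. Qed.

Let a_eq (t : R) n : t < 0 -> a n t = L t ('X * P t n * P t n) / h n t.
Proof.
move=> t0; rewrite Prec // !mulrDl !linearD /= -scalerAl linearZ /=.
rewrite Porth' // (gtn_eqF (ltnSn n)) mulr0 add0r -h_diag //.
suff -> : L t ((if n is k.+1 then b n t *: P t k else 0) * P t n) = 0.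
  by rewrite addr0 mulfK ?h0.
case: n => [|n]; first by rewrite mul0r linear0.
by rewrite -scalerAl linearZ /= Porth // (ltn_eqF (ltnSn n)) !mulr0.
Qed.

Let b_eq (t : R) k : t < 0 -> b k.+1 t = h k.+1 t / h k t.
Proof.
move=> t0; have e : L t ('X * P t k.+1 * P t k) = b k.+1 t * h k t.
  rewrite Prec // !mulrDl !linearD /= -!scalerAl !linearZ /= -h_diag //.
  rewrite !Porth' // (gtn_eqF (ltnW (ltnSn k.+1))) (gtn_eqF (ltnSn k)).
  by rewrite !mulr0 !add0r.
rewrite -[b _ _](mulfK (h0 k t0)) -e; congr (_ / _).
rewrite mulrAC mulrC Prec // !mulrDr !linearD /= -scalerAr linearZ /=.
rewrite -h_diag // !Porth' // (gtn_eqF (ltnSn k)) !mulr0 addr0.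
case: k {e} => [|k]; first by rewrite mulr0 linear0 addr0.
by rewrite -scalerAr linearZ /= Porth' // (gtn_eqF (ltnW (ltnSn k.+1))) !mulr0 addr0.
Qed.


Let derive_L (t : R) (p : R -> {poly R}) (d : {poly R}) N :
  t < 0 -> (forall s, s < 0 -> (size (p s) <= N)%N) -> coef_derive t p d ->
  is_derive t 1 (fun s => L s (p s)) (- Lt t (p t) + L t d).
Proof.
move=> t0 pN hp.
apply: (is_derive_eq (derive_moment_functional t0 pN
  (fun k => derive_m k t0) hp)).
congr (_ + _); rewrite -mulN1r -[RHS]addr0 -(mul0r (L t (p t))).
rewrite -moment_functional_comb; apply: eq_bigr => i _.
by rewrite mulN1r mul0r addr0.
Qed.

Let derive_L1 (t : R) (p : R -> {poly R}) (d : {poly R}) N :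
  t < 0 -> (forall s, s < 0 -> (size (p s) <= N)%N) -> coef_derive t p d ->
  is_derive t 1 (fun s => L1 s (p s))
    (- (ga * L1 t (p t) + be * Lt t (p t)) / (1 - t) + L1 t d).
Proof.
move=> t0 pN hp.
apply: (is_derive_eq (derive_moment_functional t0 pN
  (fun k => derive_m1 k t0) hp)).
congr (_ + _).
transitivity (- ga / (1 - t) * L1 t (p t) + - be / (1 - t) * Lt t (p t)).
  by rewrite -moment_functional_comb; apply: eq_bigr => i _; ring.
by ring.
Qed.

Let size_PM (t : R) n (q : {poly R}) : t < 0 ->
  (size (P t n * q)%R <= n + size q)%N.
Proof. by move=> t0; rewrite (leq_trans (size_polyMleq _ _)) // Psize. Qed.

(** Induction along the three-term recurrence, whose coefficients are quotients
    of moment functionals of the previous polynomials. *)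
Let derivable_P (t : R) n : t < 0 -> exists d, coef_derive t (fun s => P s n) d.
Proof.
move=> t0.
have dLPP k (d c : {poly R}) : coef_derive t (fun s => P s k) d ->
    exists e, is_derive t 1 (fun s => L s (P s k * (P s k * c))) e.
  move=> hd; have hc := coef_derive_mul hd
    (coef_derive_mul hd (coef_derive_const t c)).
  eexists; apply: (derive_L (N := (k + (k + size c))%N) t0 _ hc) => s s0.
  by rewrite (leq_trans (size_PM _ _ _)) // leq_add2l size_PM.
have dh k (d : {poly R}) : coef_derive t (fun s => P s k) d ->
    exists e, is_derive t 1 (h k) e.
  move=> /(dLPP k d 1)[e he]; exists e; apply: (derive_neg t0 _ he) => s s0.
  by rewrite mulr1 h_diag.
have dstep k (d p : {poly R}) : coef_derive t (fun s => P s k) d ->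
    coef_derive t (fun s => if k is k'.+1 then b k s *: P s k' else 0) p ->
    exists e, coef_derive t (fun s => P s k.+1) e.
  move=> hd hp; have [eh heh] := dh _ _ hd; have [ea hea] := dLPP _ _ 'X hd.
  have aE (s : R) : s < 0 -> a k s = L s (P s k * (P s k * 'X)) / h k s.
    by move=> s0; rewrite a_eq //; congr (moment_functional _ _ / _); ring.
  have ha := derive_neg t0 aE (derive_div hea heh (h0 k t0)).
  have hr := coef_derive_sub (coef_derive_sub (coef_derive_mul
    (coef_derive_const t 'X) hd) (coef_derive_scale ha hd)) hp.
  eexists; apply: (coef_derive_neg t0 _ hr) => s s0.
  by rewrite Prec // addrAC addrK addrK.
suff : (exists d, coef_derive t (fun s => P s n) d) /\
    (exists d, coef_derive t (fun s => P s n.+1) d) by case.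
have P0 (s : R) : s < 0 -> P s 0 = 1.
  move=> s0; have /monicP := Pmonic 0 s0; rewrite /lead_coef Psize //= => e.
  by rewrite [P s 0]size1_polyC ?Psize // e.
have d0 : coef_derive t (fun s => P s 0%N) 0.
  exact: coef_derive_neg t0 P0 (coef_derive_const t 1).
elim: n => [|n [[d hd] [e he]]]; split.
- by exists 0.
- exact: dstep d0 (coef_derive_const t 0).
- by exists e.
have [d1 h1] := dh _ _ hd; have [e1 g1] := dh _ _ he.
have hb := derive_neg t0 (fun s => b_eq n (t := s))
  (derive_div g1 h1 (h0 n t0)).
exact: dstep he (coef_derive_scale hb hd).
Qed.

Let Dn (t : R) n : {poly R} := \poly_(i < n) derive1 (fun s => (P s n)`_i) t.

Let Dsize (t : R) n : (size (Dn t n) <= n)%N.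
Proof. exact: size_poly. Qed.

Let derive_P (t : R) n : t < 0 -> coef_derive t (fun s => P s n) (Dn t n).
Proof.
move=> t0 i; have [d hd] := derivable_P n t0; rewrite coef_poly.
case: ltnP => [_|ni]; first by rewrite (derive1_val (hd i)); exact: hd.
apply: (derive_neg t0 _ (derive_const t (i == n)%:R)) => s s0.
move: ni; rewrite leq_eqVlt => /predU1P[<-|ni].
  by rewrite eqxx; have /monicP := Pmonic n s0; rewrite /lead_coef Psize.
by rewrite nth_default ?Psize // gtn_eqF.
Qed.

Let dpair (t : R) i j : t < 0 ->
  coef_derive t (fun s => P s i * P s j) (Dn t i * P t j + P t i * Dn t j).
Proof. by move=> t0; exact: coef_derive_mul (derive_P i t0) (derive_P j t0). Qed.

Let size_pair (t : R) i j : t < 0 -> (size (P t i * P t j)%R <= i + j.+1)%N.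
Proof. by move=> t0; rewrite (leq_trans (size_PM _ _ _)) ?Psize. Qed.

Let Plow (t : R) n (q : {poly R}) : t < 0 -> (size q <= n)%N ->
  L t (P t n * q) = 0.
Proof.
move=> t0; apply: orth_low => [k|k|i j]; first exact: Pmonic.
  exact: Psize.
exact: Porth'.
Qed.

Let DL (t : R) n (q : {poly R}) : t < 0 -> (size q <= n)%N ->
  L t (Dn t n * q) = Lt t (P t n * q).
Proof.
move=> t0 qn.
have := derive_L (N := (n + size q)%N) t0 (fun s => @size_PM s n q)
  (coef_derive_mul (derive_P n t0) (coef_derive_const t q)).
rewrite mulr0 addr0 => /derive1_val; rewrite addrC.
have L0 (s : R) : s < 0 -> L s (P s n * q) = 0 by move=> s0; exact: Plow.
rewrite (derive1_val (derive_neg t0 L0 (derive_const t 0))).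
by move/esym/eqP; rewrite subr_eq0 => /eqP.
Qed.

Let derive_h (t : R) n : t < 0 -> is_derive t 1 (h n) (- Lt t (P t n * P t n)).
Proof.
move=> t0; apply: (derive_neg t0 (fun s => h_diag n (t := s))).
apply: (is_derive_eq (derive_L t0 (fun s => @size_pair s n n) (dpair n n t0))).
by rewrite linearD /= [Dn t n * _]mulrC Plow ?Dsize // !addr0.
Qed.

(** [Rq] and [Sq] are the off-diagonal residues at [1] and [t], [rq] and [sq]
    the diagonal ones for the pair [P_(k+1), P_k], and [Xq], [Yq] the opposite
    corners. *)
Let Rq n (t : R) := L1 t (P t n * P t n) / h n t.
Let Sq n (t : R) := Lt t (P t n * P t n) / h n t.
Let rq k (t : R) := L1 t (P t k.+1 * P t k) / h k t.
Let sq k (t : R) := Lt t (P t k.+1 * P t k) / h k t.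
Let Xq k (t : R) := h k.+1 t / h k t * Rq k t.
Let Yq k (t : R) := h k.+1 t / h k t * Sq k t.
Let kappa n : R := 2 * n%:R + al + be + ga + 1.

Let Rq_Sq (t : R) n : t < 0 -> Rq n t - t * Sq n t = kappa n.
Proof.
move=> t0; have hn := h0 n t0; apply: (mulIf hn).
rewrite -(semiclassical_diag (fun p => Lt_mul p t0) (fun p => L1_mul p t0)
  (fun p => pearson p t0) (fun k => Pmonic k t0) (fun k => Psize k t0)
  (fun i j => Porth' i j t0)).
by rewrite /Rq /Sq; field.
Qed.

Let rq_sq (t : R) k : t < 0 -> rq k t - t * sq k t = - (P t k.+1)`_k.
Proof.
move=> t0; have hn := h0 k t0; apply: (mulIf hn).
rewrite -(semiclassical_offdiag (fun p => Lt_mul p t0) (fun p => L1_mul p t0)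
  (fun p => pearson p t0) (fun k => Pmonic k t0) (fun k => Psize k t0)
  (fun i j => Porth' i j t0)).
by rewrite /rq /sq; field.
Qed.

Let quad1 (t : R) k : t < 0 -> rq k t * (rq k t + be) = Rq k.+1 t * Xq k t.
Proof.
move=> t0; have hk := h0 k t0; have hk1 := h0 k.+1 t0.
have e := quadratic_at_1 (fun p => L1_mul p t0)
  (fun k => Pmonic k t0) (fun k => Psize k t0) (fun i j => Porth' i j t0) k.
rewrite /= in e.
transitivity (L1 t (P t k.+1 * P t k.+1) * L1 t (P t k * P t k) / h k t ^+ 2).
  by rewrite e /rq; field.
by rewrite /Xq /Rq; field; rewrite hk hk1.
Qed.

Let quadt (t : R) k : t < 0 -> sq k t * (sq k t - ga) = Sq k.+1 t * Yq k t.
Proof.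
move=> t0; have hk := h0 k t0; have hk1 := h0 k.+1 t0.
have e := quadratic_at_t (fun p => Lt_mul p t0)
  (fun k => Pmonic k t0) (fun k => Psize k t0) (fun i j => Porth' i j t0) k.
rewrite /= in e.
transitivity (Lt t (P t k.+1 * P t k.+1) * Lt t (P t k * P t k) / h k t ^+ 2).
  by rewrite e /sq; field.
by rewrite /Yq /Sq; field; rewrite hk hk1.
Qed.

Let quad0 (t : R) k (u := rq k t - sq k t - k.+1%:R) : t < 0 ->
  u * (u - al) = (Rq k.+1 t - Sq k.+1 t) * (Xq k t - Yq k t).
Proof.
move=> t0; have hk := h0 k t0; have hk1 := h0 k.+1 t0.
have e := quadratic_at_0 (fun p => pearson p t0)
  (fun k => Pmonic k t0) (fun k => Psize k t0) (fun i j => Porth' i j t0) k.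
rewrite /= in e.
rewrite /u /Xq /Yq /Rq /Sq /rq /sq.
set A := (X in X * _ = _) in e; set B := (X in _ * X = _) in e.
transitivity (A * B / h k t ^+ 2); first by rewrite e; field.
by rewrite /A /B; field; rewrite hk hk1.
Qed.

Let ne1 (t : R) : t < 0 -> 1 - t != 0.
Proof. by move=> t0; rewrite subr_eq0 gt_eqF // (lt_trans t0). Qed.

Let solve1 (t x y : R) : t < 0 -> (1 - t) * x = y -> x = y / (1 - t).
Proof. by move=> t0 <-; rewrite mulrAC mulfV ?ne1 // mul1r. Qed.

Let derive_R (t : R) k : t < 0 -> is_derive t 1 (Rq k.+1)
  ((2 * (sq k t * Rq k.+1 t - rq k t * Sq k.+1 t)
    - ga * Rq k.+1 t - be * Sq k.+1 t) / (1 - t) + Sq k.+1 t * Rq k.+1 t).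
Proof.
move=> t0; have hk := h0 k t0; have hk1 := h0 k.+1 t0; have t1 := ne1 t0.
have dN := derive_L1 t0 (fun s => @size_pair s k.+1 k.+1) (dpair k.+1 k.+1 t0).
have e := L1_deform_diag (fun p => Lt_mul p t0) (fun p => L1_mul p t0)
  (fun k => Pmonic k t0) (fun k => Psize k t0) (h := fun n => h n t)
  (fun k => h0 k t0)
  (fun i j => Porth' i j t0) (Dsize t) (fun n q => @DL t n q t0) k.
apply: (is_derive_eq (derive_div dN (derive_h k.+1 t0) hk1)).
rewrite /= in e; rewrite [L1 t (_ + _)]linearD [Dn t k.+1 * _]mulrC /=.
rewrite (solve1 t0 e) /sq /Rq /rq /Sq.
by field; rewrite hk hk1 t1.
Qed.

Let derive_R0 (t : R) : t < 0 -> is_derive t 1 (Rq 0)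
  ((- ga * Rq 0 t - be * Sq 0 t) / (1 - t) + Sq 0 t * Rq 0 t).
Proof.
move=> t0; have hk := h0 0 t0; have t1 := ne1 t0.
have dN := derive_L1 t0 (fun s => @size_pair s 0 0) (dpair 0 0 t0).
apply: (is_derive_eq (derive_div dN (derive_h 0 t0) hk)).
have -> : Dn t 0 = 0 by apply/eqP; rewrite -size_poly_leq0 Dsize.
rewrite mul0r mulr0 addr0 linear0 /Rq /Sq.
by field; rewrite hk t1.
Qed.

Let derive_r (t : R) k : t < 0 -> is_derive t 1 (rq k)
  ((Yq k t * Rq k.+1 t - Xq k t * Sq k.+1 t) / (1 - t)).
Proof.
move=> t0; have hk := h0 k t0; have hk1 := h0 k.+1 t0; have t1 := ne1 t0.
have dN := derive_L1 t0 (fun s => @size_pair s k.+1 k) (dpair k.+1 k t0).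
have e := L1_deform_left (fun p => Lt_mul p t0) (fun p => L1_mul p t0)
  (fun k => Pmonic k t0) (fun k => Psize k t0) (h := fun n => h n t)
  (fun k => h0 k t0)
  (fun i j => Porth' i j t0) (Dsize t) (fun n q => @DL t n q t0) k.
have e' := L1_deform_right (fun p => Lt_mul p t0) (fun p => L1_mul p t0)
  (fun k => Pmonic k t0) (fun k => Psize k t0) (h := fun n => h n t)
  (fun k => h0 k t0)
  (fun i j => Porth' i j t0) (Dsize t) (fun n q => @DL t n q t0) k.
rewrite /= in e e'; have := solve1 t0 e'.
rewrite mulrDr -scalerAr linearD linearZ /= => e2.
apply: (is_derive_eq (derive_div dN (derive_h k t0) hk)).
rewrite [L1 t (_ + _)]linearD /= (solve1 t0 e).
rewrite -[L1 t (P t k.+1 * Dn t k)](addrK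
  (Lt t (P t k * P t k) / h k t * L1 t (P t k.+1 * P t k))) e2.
rewrite /Yq /Xq /Rq /Sq.
by field; rewrite hk hk1 t1.
Qed.

(** The relation [rq - t * sq = - c], with [c] the subleading coefficient of
    [P_(k+1)], together with [c' = sq], gives [t * sq' = rq']. *)
Let derive_s (t : R) k : t < 0 -> is_derive t 1 (sq k)
  ((Yq k t * Rq k.+1 t - Xq k t * Sq k.+1 t) / (1 - t) / t).
Proof.
move=> t0; have tn0 : t != 0 by rewrite lt_eqF.
have sE (u : R) : u < 0 -> sq k u = (rq k u + (P u k.+1)`_k) / u.
  move=> u0; have un0 : u != 0 by rewrite lt_eqF.
  by rewrite -[(P u k.+1)`_k]opprK -rq_sq //; field.
apply: (derive_neg t0 sE).
have dc := derive_P k.+1 t0 k.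
have ck : (Dn t k.+1)`_k = sq k t.
  have := orth_lead (fun k => Pmonic k t0) (fun k => Psize k t0)
    (fun i j => Porth' i j t0) (Dsize t k.+1).
  by rewrite /= [P t k * _]mulrC DL ?Psize // /sq => ->; rewrite mulfK ?h0.
apply: (is_derive_eq (derive_div (derive_add (derive_r k t0) dc)
  (derive_id t) tn0)).
rewrite ck [in LHS]sE //; field; rewrite tn0 ne1 //.
Qed.

(** [b_(k+1) = h_(k+1) / h_k] and [h_n' = - Sq n * h_n]; the shift [2] is the
    difference of two consecutive values of [kappa]. *)
Theorem derive_recurrence_coefficient (t : R) k : t < 0 ->
  is_derive t 1 (b k.+1) ((2 + Rq k t - Rq k.+1 t) * b k.+1 t / t).
Proof.
move=> t0; have tn0 : t != 0 by rewrite lt_eqF.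
have hk := h0 k t0; have hk1 := h0 k.+1 t0.
apply: (derive_neg t0 (fun s => b_eq k (t := s))).
apply: (is_derive_eq (derive_div (derive_h k.+1 t0) (derive_h k t0) hk)).
have e k' : Rq k' t = t * Sq k' t + kappa k' by rewrite -(Rq_Sq k' t0) addrC subrK.
rewrite b_eq // !e /kappa /Sq -natr1.
by field; rewrite hk hk1 tn0.
Qed.

Theorem painleve6_of_orthogonality (W : R -> R) n (t : R) :
  (forall t : R, t < 0 -> W t = (t - 1) * Rq n t / kappa n + 1) ->
  kappa n != 0 -> t < 0 -> W t != 0 -> W t != 1 -> W t != t ->
  painleve6_at (kappa n ^+ 2 / 2) (- (al ^+ 2 / 2)) (be ^+ 2 / 2)
    ((1 - ga ^+ 2) / 2) W t.
Proof.
case: n => [|k] hW.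
  (* there is no polynomial before P_0, and the system closes with all
     quantities that would involve it equal to 0 *)
  apply: (painleve6_of_system (q := Rq 0) (S := Sq 0) (r := fun=> 0)
    (s := fun=> 0) (X := fun=> 0) (Y := fun=> 0)) => // u u0.
  - exact: Rq_Sq.
  - by ring.
  - by ring.
  - by ring.
  - by apply: (is_derive_eq (derive_R0 u0)); ring.
  - by apply: (is_derive_eq (derive_const u 0)); ring.
  - by apply: (is_derive_eq (derive_const u 0)); ring.
apply: (painleve6_of_system (q := Rq k.+1) (S := Sq k.+1) (r := rq k)
  (s := sq k) (X := Xq k) (Y := Yq k)) => // u u0.
- exact: Rq_Sq.
- exact: quad1.
- exact: quadt.
- exact: quad0.
- exact: derive_R.
- exact: derive_r.
- exact: derive_s.
Qed.

End Evolution.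

(** * Improper integrals on the unit interval *)

Section UnitIntervalIntegrals.
Variable R : realType.
Notation mu := (@lebesgue_measure R).
Notation integrable01 f := (mu.-integrable `[0, 1] (EFin \o f)).
Implicit Types (f g F : R -> R) (s t x : R).

Lemma continuous_point_within f (a b : R) :
  (forall x, a <= x <= b -> {for x, continuous f}) ->
  {within `[a, b], continuous f}.
Proof.
move=> cf; apply: continuous_in_subspaceT => x.
by rewrite inE /= in_itv /=; exact: cf.
Qed.

Lemma integrable01_mulC f g : (forall x, 0 <= x <= 1 -> {for x, continuous f}) ->
  integrable01 g -> integrable01 (fun x => f x * g x).
Proof.
move=> /continuous_point_within cf ig.
have mf : measurable_fun (`[0, 1] : set (measurableTypeR R)) f.
  exact: subspace_continuous_measurable_fun.
have bf : [bounded f x | x in (`[0, 1] : set R)].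
  have /compact_bounded := continuous_compact cf (@segment_compact _ 0 1).
  move=> [M [Mr HM]]; exists M; split => // N MN x x01.
  by apply: HM MN _ _; exists x.
have := integrableMr _ mf bf ig.
by apply; exact: measurable_itv.
Qed.

(** The improper integral of a nonnegative derivative is finite: it is the
    increment of the primitive. *)
Lemma integrable01_derive f F :
  (forall x, 0 <= x < 1 -> 0 <= f x) ->
  (forall x, 0 <= x < 1 -> {for x, continuous f}) ->
  {for 0, continuous F} -> {for 1, continuous F} ->
  (forall x, 0 < x < 1 -> is_derive x 1 F (f x)) ->
  integrable01 f.
Proof.
move=> f0 cf cF0 cF1 dF.
pose c n : R := 1 - n.+2%:R^-1.
have c0 n : 0 < c n by rewrite subr_gt0 invf_lt1 ?ltr1n.
have c1 n : c n < 1 by rewrite ltrBlDr ltrDl invr_gt0.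
have mf : measurable_fun (`[0, 1[ : set (measurableTypeR R)) f.
  apply: subspace_continuous_measurable_fun => //.
  apply: continuous_in_subspaceT => x; rewrite inE /= in_itv /=; exact: cf.
have mfc n : measurable_fun (`[0, c n] : set (measurableTypeR R)) f.
  apply: measurable_funS mf => //; apply: subset_itvl; rewrite bnd_simp.
  exact: c1.
have Ic n : (\int[mu]_(x in `[0%R, c n]) (f x)%:E = (F (c n) - F 0)%:E)%E.
  rewrite (continuous_FTC2 (F := F)) //.
  - apply: continuous_point_within => x /andP[x0 xc].
    by apply: cf; rewrite x0 (le_lt_trans xc).
  - split.
    + move=> x; rewrite in_itv /= => /andP[x0 xc].
      have x1 := lt_trans xc (c1 n).
      by case: (dF x _); rewrite ?x0.
    + exact: cvg_at_right_filter.
    + apply: cvg_at_left_filter; apply: differentiable_continuous.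
      apply/derivable1_diffP.
      by case: (dF (c n) _) => //; rewrite c0 c1.
  - move=> x; rewrite in_itv /= => /andP[x0 xc].
    by apply: derive1_val; apply: dF; rewrite x0 (lt_trans xc).
have cvc : c n @[n --> \oo] --> (1 : R).
  rewrite -[X in _ --> X]subr0; apply: cvgB; first exact: cvg_cst.
  rewrite (_ : (fun _ => _) = fun n => (@harmonic R) (n + 1)%N).
    by rewrite cvg_shiftn; exact: cvg_harmonic.
  by apply/funext => n; rewrite addn1.
have cup : \bigcup_n `[0, c n]%classic = `[0, 1[%classic.
  apply/seteqP; split => [x [n _] /=|x /=]; rewrite !in_itv /=.
    by move=> /andP[-> xc] /=; rewrite (le_lt_trans xc).
  move=> /andP[x0 x1]; have /cvgrPdist_lt/(_ (1 - x)) := cvc.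
  rewrite subr_gt0 => /(_ x1)[N _ /(_ N (leqnn N)) /=].
  rewrite ltr_distlC => /andP[h _]; exists N => //=.
  by rewrite in_itv /= x0 /= ltW // (le_lt_trans _ h) // subKr.
have nd : nondecreasing_seq (fun n => `[0, c n]%classic : set (measurableTypeR R)).
  apply/nondecreasing_seqP => n; rewrite subsetEset; apply: subset_itvl.
  by rewrite bnd_simp lerD2l lerN2 lef_pV2 ?posrE // ler_nat.
have f0c n x : `[0, c n]%classic x -> (0 <= (EFin \o f) x)%E.
  rewrite /= in_itv /= => /andP[x0 xc].
  by rewrite lee_fin f0 // x0 (le_lt_trans xc).
have mfE n : measurable_fun (`[0, c n] : set (measurableTypeR R)) (EFin \o f).
  exact/measurable_EFinP.
have cvI := ge0_nondecreasing_set_cvg_integral (mu := mu) nd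
  (fun=> measurable_itv _) mfE f0c.
have cvF : ((F (c n) - F 0)%:E @[n --> \oo] --> (F 1 - F 0)%:E)%E.
  apply: cvg_EFin; first exact: nearW.
  apply: cvgB; last exact: cvg_cst.
  exact: (cvg_comp _ _ cvc cF1).
rewrite cup (eq_cvg _ _ Ic) in cvI.
have I1 := cvg_unique (@ereal_hausdorff R) cvI cvF.
have mf1 : measurable_fun (`[0, 1] : set (measurableTypeR R)) f.
  exact/measurable_fun_itv_bndo_bndcP.
apply/integrableP; split; first exact/measurable_EFinP.
rewrite -integral_itv_bndo_bndc; last first.
  by apply: measurableT_comp => //; exact/measurable_EFinP.
suff -> : (\int[mu]_(x in `[0%R, 1%R[) `|(EFin \o f) x| =
           \int[mu]_(x in `[0%R, 1%R[) (EFin \o f) x)%E by rewrite I1 ltry.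
apply: eq_integral => x.
rewrite inE /= in_itv /= => x01.
by rewrite ger0_norm ?f0.
Qed.


(** The fundamental theorem of calculus with an integrable singularity at [1],
    as the limit of its version on the intervals from [0] to [c < 1]. *)
Lemma Rintegral_derive_unit_interval f F :
  integrable01 f ->
  (forall x, 0 <= x < 1 -> {for x, continuous f}) ->
  {for 0, continuous F} -> {for 1, continuous F} ->
  (forall x, 0 < x < 1 -> is_derive x 1 F (f x)) ->
  \int[mu]_(x in `[0, 1]) f x = F 1 - F 0.
Proof.
move=> fi cf cF0 cF1 dF.
have Ic c : 0 < c < 1 -> \int[mu]_(x in `[0, c]) f x = F c - F 0.
  move=> /andP[c0 c1]; rewrite /Rintegral (continuous_FTC2 (F := F)) //.
  - apply: continuous_point_within => x /andP[x0 xc].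
    by apply: cf; rewrite x0 (le_lt_trans xc).
  - split.
    + move=> x; rewrite in_itv /= => /andP[x0 xc].
      by case: (dF x _); rewrite ?x0 ?(lt_trans xc).
    + exact: cvg_at_right_filter.
    + apply: cvg_at_left_filter; apply: differentiable_continuous.
      apply/derivable1_diffP.
      by case: (dF c _) => //; rewrite c0 c1.
  - move=> x; rewrite in_itv /= => /andP[x0 xc].
    by apply: derive1_val; apply: dF; rewrite x0 (lt_trans xc).
have cI := parameterized_integral_cvg_at_left ltr01 fi.
have cF : parameterized_integral mu 0 x f @[x --> 1^'-] --> F 1 - F 0.
  have : F x - F 0 @[x --> 1^'-] --> F 1 - F 0.
    by apply: cvgB; [exact: cvg_at_left_filter|exact: cvg_cst].
  apply: cvg_trans; apply: near_eq_cvg; near=> x.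
  rewrite /parameterized_integral Ic //; apply/andP; split.
    by near: x; exact: nbhs_left_gt.
  by near: x; exact: nbhs_left_lt.
exact: (cvg_unique _ cI cF).
Unshelve. all: by end_near. Qed.

(** Differentiation under the integral sign: for [s] between [t - 1] and
    [t / 2] and [x] in the unit interval, [x - s] stays in a compact set of
    positive numbers, so that the derivative of the power is dominated by a
    constant. *)
Lemma derive_power_shift_integral (rho : R -> R) (g t : R) :
  integrable01 rho -> t < 0 ->
  is_derive t 1 (fun s => \int[mu]_(x in `[0, 1]) ((x - s) `^ g * rho x))
    (- (g * \int[mu]_(x in `[0, 1]) ((x - t) `^ g * rho x / (x - t)))).
Proof.
move=> irho t0.
have pos s x : s < 0 -> 0 <= x -> 0 < x - s.
  by move=> s0 x0; rewrite subr_gt0 (lt_le_trans s0).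
have cpow (g' : R) y : 0 < y -> {for y, continuous (fun z : R => z `^ g')}.
  move=> y0; apply: differentiable_continuous; apply/derivable1_diffP.
  by case: (is_derive1_powR g' y0).
have cshift s (g' : R) x : s < 0 -> 0 <= x <= 1 ->
    {for x, continuous (fun y => (y - s) `^ g')}.
  move=> s0 /andP[x0 _].
  apply: (@continuous_comp _ _ _ (fun y => y - s) (fun z : R => z `^ g')).
    by apply: cvgB; [exact: cvg_id|exact: cvg_cst].
  exact/cpow/pos.
have iF s : s < 0 -> integrable01 (fun x => (x - s) `^ g * rho x).
  by move=> s0; apply: integrable01_mulC irho => x; exact: cshift.
have [K K0 HK] : exists2 K, 0 <= K &
    forall z : R, - (t / 2) <= z <= 2 - t -> `|g * z `^ (g - 1)| <= K.
  have ab : - (t / 2) <= 2 - t by lra.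
  have cz : {within `[- (t / 2), 2 - t], continuous (fun z : R => z `^ (g - 1))}.
    by apply: continuous_point_within => z /andP[z0 _]; apply: cpow; lra.
  have [c _ Hc] := EVT_max ab cz.
  exists (`|g| * c `^ (g - 1)); first by rewrite mulr_ge0 ?powR_ge0.
  move=> z zab; rewrite normrM (ger0_norm (powR_ge0 _ _)).
  by rewrite ler_wpM2l //; apply: Hc; rewrite in_itv.
have df s x : s < 0 -> 0 <= x -> is_derive s 1
    (fun u => (x - u) `^ g * rho x) (- (g * (x - s) `^ (g - 1) * rho x)).
  move=> s0 x0.
  have d1 : is_derive s 1 (fun u => x - u) (0 - 1).
    exact: derive_sub (derive_const _ _) (derive_id _).
  have d3 := derive_powR g d1 (pos _ _ s0 x0).
  apply: (is_derive_eq (derive_mul d3 (derive_const s (rho x)))).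
  by ring.
pose f s x := (x - s) `^ g * rho x.
have It : (`]t - 1, t / 2[%classic : set R) t by rewrite /= in_itv /=; lra.
have Ineg s : (`]t - 1, t / 2[%classic : set R) s -> s < 0.
  by rewrite /= in_itv /= => /andP[]; lra.
have f01 x : (`[0, 1]%classic : set R) x -> 0 <= x <= 1 by rewrite /= in_itv.
have dx s x : (`]t - 1, t / 2[%classic : set R) s ->
    (`[0, 1]%classic : set R) x -> derivable (f ^~ x) s 1.
  by move=> /Ineg s0 /f01/andP[x0 _]; case: (df s x s0 x0).
have G0 y : 0 <= K * `|rho y| by rewrite mulr_ge0.
have mI : measurable (`[0, 1] : set (measurableTypeR R)) by exact: measurable_itv.
have iG : integrable01 (fun y => K * `|rho y|).
  exact: (integrableZl mI K (integrable_norm irho)).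
have G_ub s x : (`]t - 1, t / 2[%classic : set R) s ->
    (`[0, 1]%classic : set R) x -> `|partial1of2 f s x| <= K * `|rho x|.
  move=> Is /f01/andP[x0 x1]; rewrite /partial1of2.
  rewrite (derive1_val (df s x (Ineg _ Is) x0)).
  rewrite normrN normrM ler_wpM2r //; apply: HK.
  by move: Is; rewrite /= in_itv /= => /andP[]; lra.
have if' s : (`]t - 1, t / 2[%classic : set R) s -> integrable01 (f s).
  by move=> /Ineg; exact: iF.
apply: DeriveDef.
  exact: (derivable_under_integral mI It if' dx G0 iG G_ub).
rewrite -derive1E (differentiation_under_integral mI It if' dx G0 iG G_ub).
rewrite -mulNr -RintegralZl //; last first.
  rewrite (_ : _ \o _ = EFin \o (fun x => (x - t)^-1 * ((x - t) `^ g * rho x))).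
    apply: integrable01_mulC (iF _ t0) => x /andP[x0 x1].
    apply: cvgV; first by rewrite gt_eqF ?pos.
    by apply: cvgB; [exact: cvg_id|exact: cvg_cst].
  by apply/funext => x /=; rewrite mulrC.
apply: eq_Rintegral => x; rewrite inE => /f01/andP[x0 x1].
rewrite /partial1of2 (derive1_val (df t x t0 x0)).
have xt := pos _ _ t0 x0.
rewrite powRB; last by rewrite (gt_eqF xt) implybT.
by rewrite powRr1 ?ltW //; ring.
Qed.

End UnitIntervalIntegrals.

(** * Moments of the deformed Jacobi weight *)

Section JacobiMoments.
Variable R : realType.
Notation mu := (@lebesgue_measure R).
Notation integrable01 f := (mu.-integrable `[0, 1] (EFin \o f)).
Implicit Types (s t x a b : R) (f g v : R -> R).

(** The real power extended by [0] to negative numbers. The library power is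
    [1] there, hence discontinuous at [0]; this one is continuous everywhere
    for a positive exponent. *)
Definition pow0 a x : R := if 0 < x then x `^ a else 0.

Lemma pow0E a x : 0 < a -> 0 <= x -> pow0 a x = x `^ a.
Proof.
move=> a0; rewrite /pow0 le_eqVlt => /predU1P[<-|->//].
by rewrite ltxx powR0 // gt_eqF.
Qed.

Lemma derive_pow0 a x : 0 < x -> is_derive x 1 (pow0 a) (a * (pow0 a x / x)).
Proof.
move=> x0; apply: (near_eq_is_derive (f := fun z => z `^ a)).
  by near=> z; rewrite /pow0 ifT //; near: z; exact: lt_nbhsr.
apply: (is_derive_eq (is_derive1_powR a x0)).
by rewrite /pow0 x0 powRB ?(gt_eqF x0) ?implybT // powRr1 // ltW.
Unshelve. all: by end_near. Qed.

Lemma continuous_pow0 a : 0 < a -> continuous (pow0 a).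
Proof.
move=> a0 x; have [x0|x0|->] := ltgtP x 0.
- rewrite /continuous_at /pow0 ltNge (ltW x0) /=.
  apply: cvg_near_cst; near=> z.
  by rewrite ltNge ltW //; near: z; exact: lt_nbhsl.
- apply: differentiable_continuous; apply/derivable1_diffP.
  by case: (derive_pow0 a x0).
- apply/cvgrPdist_lt => e e0; have -> : pow0 a 0 = 0 by rewrite /pow0 ltxx.
  near=> z; rewrite sub0r normrN /pow0; case: ifPn => z0; last by rewrite normr0.
  rewrite ger0_norm ?powR_ge0 //.
  rewrite -[ltRHS](@powRr1 _ e) ?ltW // -(mulVf (lt0r_neq0 a0)) powRrM.
  apply: gt0_ltr_powR; rewrite ?nnegrE ?powR_ge0 ?ltW //.
  by near: z; apply: lt_nbhsl; exact: powR_gt0.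
Unshelve. all: by end_near. Qed.

Lemma continuous_horner (p : {poly R}) : continuous (horner p).
Proof.
by move=> x; apply: differentiable_continuous; exact/derivable1_diffP/derivable_horner.
Qed.

Lemma moment_functional_Rintegral v (p : {poly R}) : integrable01 v ->
  moment_functional (fun k => \int[mu]_(x in `[0, 1]) (x ^+ k * v x)) p =
  \int[mu]_(x in `[0, 1]) (p.[x] * v x).
Proof.
move=> iv.
have ip (q : {poly R}) : integrable01 (fun x => q.[x] * v x).
  by apply: integrable01_mulC iv => x _; exact: continuous_horner.
have mI : measurable (`[0, 1] : set (measurableTypeR R)) by exact: measurable_itv.
apply: (scalar_polyP
  (g := fun p : {poly R} => \int[mu]_(x in `[0, 1]) (p.[x] * v x))).
- by move=> c q r; rewrite linearP.
- move=> c q r; rewrite -RintegralZl // -RintegralD //.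
    by apply: eq_Rintegral => x _; rewrite hornerD hornerZ; ring.
  exact: (integrableZl mI c (ip q)).
- move=> k; rewrite moment_functionalXn.
  by apply: eq_Rintegral => x _; rewrite hornerXn.
Qed.

Lemma integrable01Z f a : integrable01 f -> integrable01 (fun x => a * f x).
Proof.
have mI : measurable (`[0, 1] : set (measurableTypeR R)) by exact: measurable_itv.
by move=> fi; exact: (integrableZl mI a fi).
Qed.

Lemma integrable01D f g : integrable01 f -> integrable01 g ->
  integrable01 (fun x => f x + g x).
Proof.
have mI : measurable (`[0, 1] : set (measurableTypeR R)) by exact: measurable_itv.
by move=> fi gi; exact: (integrableD mI fi gi).
Qed.

Lemma RintegralDZ f g a b : integrable01 f -> integrable01 g ->
  \int[mu]_(x in `[0, 1]) (a * f x + b * g x) =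
  a * \int[mu]_(x in `[0, 1]) f x + b * \int[mu]_(x in `[0, 1]) g x.
Proof.
have mI : measurable (`[0, 1] : set (measurableTypeR R)) by exact: measurable_itv.
move=> fi gi; rewrite RintegralD // ?RintegralZl //.
  exact: (integrableZl mI a fi).
exact: (integrableZl mI b gi).
Qed.

Variables al be ga : R.
Hypotheses (al0 : 0 < al) (be0 : 0 < be).

Let bump x := pow0 al x * pow0 be (1 - x).

Let weightE t x : 0 <= x <= 1 -> weight al be ga t x = (x - t) `^ ga * bump x.
Proof.
move=> /andP[x0 x1]; rewrite /weight /bump !pow0E ?subr_ge0 //.
by rewrite mulrA.
Qed.

Let in01 x : x \in (`[0, 1]%classic : set R) -> 0 <= x <= 1.
Proof. by rewrite inE /= in_itv. Qed.

Let pos t x : t < 0 -> 0 <= x -> 0 < x - t.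
Proof. by move=> t0 x0; rewrite subr_gt0 (lt_le_trans t0). Qed.

Let continuous_onem x : {for x, continuous (fun y : R => 1 - y)}.
Proof. by apply: cvgB; [exact: cvg_cst|exact: cvg_id]. Qed.

Let continuous_shift t x : {for x, continuous (fun y : R => y - t)}.
Proof. by apply: cvgB; [exact: cvg_id|exact: cvg_cst]. Qed.

Let continuous_pow0_onem x : {for x, continuous (fun y : R => pow0 be (1 - y))}.
Proof.
apply: (@continuous_comp _ _ _ (fun y : R => 1 - y) (pow0 be)).
  exact: continuous_onem.
exact: continuous_pow0.
Qed.

Let derive_pow0_onem x : x < 1 ->
  is_derive x 1 (fun y : R => pow0 be (1 - y)) (- (be * (pow0 be (1 - x) / (1 - x)))).
Proof.
move=> x1; have x1' : 0 < 1 - x by rewrite subr_gt0.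
have d1 := derive_sub (derive_const x 1) (derive_id x).
apply: (is_derive_eq (@is_derive1_comp _ (pow0 be) (fun y : R => 1 - y) x _ _
  (derive_pow0 be x1') d1)).
by ring.
Qed.

Let continuous_bump : continuous bump.
Proof.
by move=> x; apply: cvgM; [exact: continuous_pow0|exact: continuous_pow0_onem].
Qed.

Let continuous_onemV x : x < 1 -> {for x, continuous (fun y : R => (1 - y)^-1)}.
Proof.
by move=> x1; apply: cvgV; [rewrite subr_eq0 gt_eqF|exact: continuous_onem].
Qed.

Let continuous_power t x : t < 0 -> 0 <= x ->
  {for x, continuous (fun y : R => (y - t) `^ ga)}.
Proof.
move=> t0 x0; apply: differentiable_continuous; apply/derivable1_diffP.
have d := derive_powR ga (derive_sub (derive_id x) (derive_const x t)) (pos t0 x0).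
by case: d.
Qed.

Let continuous_inv_shift t x : t < 0 -> 0 <= x ->
  {for x, continuous (fun y : R => (y - t)^-1)}.
Proof.
move=> t0 x0; apply: cvgV; first by rewrite gt_eqF ?pos.
exact: continuous_shift.
Qed.

Let integrable_bump : integrable01 bump.
Proof.
apply: continuous_compact_integrable; first exact: segment_compact.
by apply: continuous_subspaceT; exact: continuous_bump.
Qed.

(** The derivative of [- (1 - x) ^ be] has the required singularity at [1]. *)
Let integrable_bump1 : integrable01 (fun x => bump x / (1 - x)).
Proof.
have i1 : integrable01 (fun x => be * (pow0 be (1 - x) / (1 - x))).
  apply: (integrable01_derive (F := fun x => 0 - pow0 be (1 - x))).
  - move=> x /andP[x0 x1]; rewrite mulr_ge0 ?ltW // divr_gt0 ?subr_gt0 //.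
    by rewrite /pow0 subr_gt0 x1 powR_gt0 // subr_gt0.
  - move=> x /andP[x0 x1]; apply: cvgM; first exact: cvg_cst.
    by apply: cvgM; [exact: continuous_pow0_onem|exact: continuous_onemV].
  - by apply: cvgB; [exact: cvg_cst|exact: continuous_pow0_onem].
  - by apply: cvgB; [exact: cvg_cst|exact: continuous_pow0_onem].
  - move=> x /andP[x0 x1].
    apply: (is_derive_eq (derive_sub (derive_const x 0) (derive_pow0_onem x1))).
    by rewrite sub0r opprK.
rewrite (_ : _ \o _ =
    EFin \o (fun x => be^-1 * pow0 al x * (be * (pow0 be (1 - x) / (1 - x))))).
  apply: integrable01_mulC i1 => x _.
  by apply: cvgM; [exact: cvg_cst|exact: continuous_pow0].
apply/funext => x /=; congr EFin; rewrite /bump -[LHS]mulrA.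
by set B := (pow0 be _ / _); field; rewrite gt_eqF.
Qed.

Let integrable_power t (g : R -> R) : t < 0 -> integrable01 g ->
  integrable01 (fun x => (x - t) `^ ga * g x).
Proof.
move=> t0 ig; apply: integrable01_mulC ig => x /andP[x0 _].
exact: continuous_power.
Qed.

Let integrable01_eq f g : (forall x, 0 <= x <= 1 -> f x = g x) ->
  integrable01 f -> integrable01 g.
Proof.
move=> fg; apply: eq_integrable => [|x /in01 x01]; first exact: measurable_itv.
by rewrite /= fg.
Qed.

Lemma integrable_weight t : t < 0 -> integrable01 (weight al be ga t).
Proof.
move=> t0; apply: (integrable01_eq _ (integrable_power t0 integrable_bump)) => x x01.
by rewrite weightE.
Qed.

Lemma integrable_weight_shift t : t < 0 ->
  integrable01 (fun x => weight al be ga t x / (x - t)).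
Proof.
move=> t0; rewrite (_ : _ \o _ =
    EFin \o (fun x => (x - t)^-1 * weight al be ga t x)).
  apply: integrable01_mulC (integrable_weight t0) => x /andP[x0 _].
  exact: continuous_inv_shift.
by apply/funext => x /=; rewrite mulrC.
Qed.

Lemma integrable_weight_onem t : t < 0 ->
  integrable01 (fun x => weight al be ga t x / (1 - x)).
Proof.
move=> t0; apply: (integrable01_eq _ (integrable_power t0 integrable_bump1)) => x x01.
by rewrite weightE // mulrA.
Qed.

(** The second and third families are the moments of the weight divided by
    [x - t] and [1 - x], with the exponents as normalisation. *)
Definition jacobi_moment k t :=
  \int[mu]_(x in `[0, 1]) (x ^+ k * weight al be ga t x).
Definition jacobi_moment_t k t :=
  ga * \int[mu]_(x in `[0, 1]) (x ^+ k * (weight al be ga t x / (x - t))).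
Definition jacobi_moment_1 k t :=
  be * \int[mu]_(x in `[0, 1]) (x ^+ k * (weight al be ga t x / (1 - x))).

Let integrable_pow k f : integrable01 f -> integrable01 (fun x => x ^+ k * f x).
Proof.
move=> fi; apply: (integrable01_eq (f := fun x => ('X^k).[x] * f x)).
  by move=> x _; rewrite hornerXn.
by apply: integrable01_mulC fi => x _; exact: continuous_horner.
Qed.

Let weight1 t : weight al be ga t 1 = 0.
Proof. by rewrite /weight subrr powR0 ?mulr0 // gt_eqF. Qed.

Lemma jacobi_moment_t_step t k : t < 0 ->
  jacobi_moment_t k.+1 t = t * jacobi_moment_t k t + ga * jacobi_moment k t.
Proof.
move=> t0; rewrite /jacobi_moment_t /jacobi_moment mulrCA -mulrDr; congr (_ * _).
rewrite -[X in _ = _ + X]mul1r -RintegralDZ //.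
- apply: eq_Rintegral => x /in01/andP[x0 x1]; rewrite exprS.
  by field; rewrite gt_eqF // pos.
- exact: integrable_pow (integrable_weight_shift t0).
- exact: integrable_pow (integrable_weight t0).
Qed.

Lemma jacobi_moment_1_step t k : t < 0 ->
  jacobi_moment_1 k.+1 t = jacobi_moment_1 k t - be * jacobi_moment k t.
Proof.
move=> t0; rewrite /jacobi_moment_1 /jacobi_moment -mulrBr; congr (_ * _).
rewrite -[X in _ = X - _]mul1r -mulN1r -RintegralDZ //.
- apply: eq_Rintegral => x /in01/andP[x0 x1]; rewrite exprS.
  have [->|xn1] := eqVneq x 1; first by rewrite weight1; ring.
  by field; rewrite subr_eq0 eq_sym.
- exact: integrable_pow (integrable_weight_onem t0).
- exact: integrable_pow (integrable_weight t0).
Qed.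

Lemma derive_jacobi_moment t k : t < 0 ->
  is_derive t 1 (jacobi_moment k) (- jacobi_moment_t k t).
Proof.
move=> t0; have ir := integrable_pow k integrable_bump.
apply: (derive_neg t0 _ (is_derive_eq (derive_power_shift_integral ga ir t0) _)).
  move=> s s0; apply: eq_Rintegral => x /in01 x01.
  by rewrite weightE //; ring.
congr (- (_ * _)); apply: eq_Rintegral => x /in01 x01.
by rewrite weightE //; ring.
Qed.

(** [(1 - t) / ((x - t) (1 - x)) = 1 / (x - t) + 1 / (1 - x)]. *)
Lemma derive_jacobi_moment_1 t k : t < 0 ->
  is_derive t 1 (jacobi_moment_1 k)
    (- (ga * jacobi_moment_1 k t + be * jacobi_moment_t k t) / (1 - t)).
Proof.
move=> t0; have ir := integrable_pow k integrable_bump1.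
have t1 : 1 - t != 0 by rewrite subr_eq0 gt_eqF // (lt_trans t0).
have d := derive_mul (derive_const t be) (derive_power_shift_integral ga ir t0).
apply: (derive_neg t0 _ (is_derive_eq d _)).
  move=> s s0; congr (_ * _); apply: eq_Rintegral => x /in01 x01.
  by rewrite weightE //; ring.
rewrite mul0r add0r /jacobi_moment_1 /jacobi_moment_t.
set I := (X in be * - (ga * X)).
have -> : I = (1 - t)^-1 * \int[mu]_(x in `[0, 1])
        (x ^+ k * (weight al be ga t x / (1 - x)))
    + (1 - t)^-1 * \int[mu]_(x in `[0, 1])
        (x ^+ k * (weight al be ga t x / (x - t))).
  rewrite -RintegralDZ.
  - apply: eq_Rintegral => x /in01 x01; rewrite weightE //.
    have xt : x - t != 0 by rewrite gt_eqF // pos //; case/andP: x01.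
    (* at x = 1 the quotients are 0 by convention, and so is the weight *)
    have [xe|xn1] := eqVneq x 1.
      by rewrite xe /bump subrr /pow0 ltxx; ring.
    have xn1' : 1 - x != 0 by rewrite subr_eq0 eq_sym.
    by field; rewrite xt t1 xn1'.
  - exact: integrable_pow (integrable_weight_onem t0).
  - exact: integrable_pow (integrable_weight_shift t0).
by field.
Qed.

(** [x ^ (k + 1) * w] vanishes at both ends of the unit interval, because both
    exponents there are positive. *)
Lemma jacobi_pearson t k : t < 0 ->
  jacobi_moment_1 k.+1 t - jacobi_moment_t k.+1 t =
  (k.+1%:R + al) * jacobi_moment k t.
Proof.
move=> t0.
pose w x := (x - t) `^ ga * bump x.
pose F x := x ^+ k.+1 * w x.
pose f x := (k.+1%:R + al) * (x ^+ k * w x)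
  + 1 * (ga * (x ^+ k.+1 * (w x / (x - t)))
         + - be * (x ^+ k.+1 * (w x / (1 - x)))).
have cw x : 0 <= x -> {for x, continuous w}.
  by move=> x0; apply: cvgM; [exact: continuous_power|exact: continuous_bump].
have cX n x : {for x, continuous (fun y : R => y ^+ n)}.
  by apply: differentiable_continuous; apply/derivable1_diffP; exact: exprn_derivable.
have iw : integrable01 w by exact: integrable_power integrable_bump.
have iwt : integrable01 (fun x => w x / (x - t)).
  apply: (integrable01_eq _ (integrable_weight_shift t0)) => x x01.
  by rewrite weightE.
have iw1 : integrable01 (fun x => w x / (1 - x)).
  apply: (integrable01_eq _ (integrable_weight_onem t0)) => x x01.
  by rewrite weightE.
have ig : integrable01 (fun x => ga * (x ^+ k.+1 * (w x / (x - t)))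
    + - be * (x ^+ k.+1 * (w x / (1 - x)))).
  by apply: integrable01D; apply: integrable01Z; exact: integrable_pow.
have If : integrable01 f.
  by apply: integrable01D; apply: integrable01Z => //; exact: integrable_pow.
have F0 : F 1 - F 0 = 0.
  by rewrite /F /w /bump subrr /pow0 ltxx exprS; ring.
have dF x : 0 < x < 1 -> is_derive x 1 F (f x).
  move=> /andP[x0 x1].
  have dX : is_derive x 1 (fun y : R => y ^+ k.+1) (k.+1%:R * x ^+ k).
    apply: DeriveDef; first exact: exprn_derivable.
    by rewrite exp_derive /GRing.scale /= mulr1.
  have dp := derive_powR ga (derive_sub (derive_id x) (derive_const x t))
    (pos t0 (ltW x0)).
  apply: (is_derive_eq (derive_mul dX (derive_mul dp
    (derive_mul (derive_pow0 al x0) (derive_pow0_onem x1))))).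
  have xt := pos t0 (ltW x0).
  rewrite /f /w /bump powRB ?(gt_eqF xt) ?implybT // powRr1 ?ltW // exprS.
  by field; rewrite !gt_eqF // subr_gt0.
have cf x : 0 <= x < 1 -> {for x, continuous f}.
  move=> /andP[x0 x1]; apply: cvgD; apply: cvgM; try exact: cvg_cst.
    by apply: cvgM; [exact: cX|exact: cw].
  apply: cvgD; apply: cvgM; try exact: cvg_cst.
    apply: cvgM; first exact: cX.
    by apply: cvgM; [exact: cw|exact: continuous_inv_shift].
  apply: cvgM; first exact: cX.
  by apply: cvgM; [exact: cw|exact: continuous_onemV].
have cF x : 0 <= x -> {for x, continuous F}.
  by move=> x0; apply: cvgM; [exact: cX|exact: cw].
have := Rintegral_derive_unit_interval If cf (cF 0 (lexx 0)) (cF 1 ler01) dF.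
rewrite F0 RintegralDZ //; last exact: integrable_pow.
rewrite RintegralDZ; [|exact: integrable_pow|exact: integrable_pow].
have wE x : x \in (`[0, 1]%classic : set R) -> w x = weight al be ga t x.
  by move=> /in01 x01; rewrite weightE.
have -> : \int[mu]_(x in `[0, 1]) (x ^+ k * w x) = jacobi_moment k t.
  by apply: eq_Rintegral => x /wE ->.
have -> : \int[mu]_(x in `[0, 1]) (x ^+ k.+1 * (w x / (x - t))) =
    \int[mu]_(x in `[0, 1]) (x ^+ k.+1 * (weight al be ga t x / (x - t))).
  by apply: eq_Rintegral => x /wE ->.
have -> : \int[mu]_(x in `[0, 1]) (x ^+ k.+1 * (w x / (1 - x))) =
    \int[mu]_(x in `[0, 1]) (x ^+ k.+1 * (weight al be ga t x / (1 - x))).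
  by apply: eq_Rintegral => x /wE ->.
rewrite mul1r -/(jacobi_moment_t k.+1 t) mulNr -/(jacobi_moment_1 k.+1 t) => e.
apply/eqP; rewrite -subr_eq0 -oppr_eq0 -[X in _ == X]e; apply/eqP; ring.
Qed.

End JacobiMoments.

(** * The differential equations *)

Theorem theorem1p2 (R : realType) (alpha beta gamma : R)
    (halpha : 0 < alpha) (hbeta : 0 < beta)
    (P : R -> nat -> {poly R}) (h a b : nat -> R -> R)
    (hP : forall t : R, t < 0 ->
      monic_orthogonal (weight alpha beta gamma t) (P t) (fun n => h n t))
    (hrec : forall t : R, t < 0 ->
      three_term_recurrence (P t) (fun n => a n t) (fun n => b n t)) :
  (forall (n : nat) (t : R), (1 <= n)%N -> t < 0 ->
     derivable (b n) t 1 /\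
     t * derive1 (b n) t =
       (2 + Rn alpha beta gamma P h n.-1 t - Rn alpha beta gamma P h n t)
         * b n t)
  /\
  (forall (n : nat) (t : R),
     2 * n%:R + alpha + beta + gamma + 1 != 0 -> t < 0 ->
     Wn alpha beta gamma P h n t != 0 ->
     Wn alpha beta gamma P h n t != 1 ->
     Wn alpha beta gamma P h n t != t ->
     painleve6_at
       ((2 * n%:R + alpha + beta + gamma + 1) ^+ 2 / 2)
       (- (alpha ^+ 2 / 2))
       (beta ^+ 2 / 2)
       ((1 - gamma ^+ 2) / 2)
       (Wn alpha beta gamma P h n) t).

Proof.
pose m := jacobi_moment alpha beta gamma.
pose mt := jacobi_moment_t alpha beta gamma.
pose m1 := jacobi_moment_1 alpha beta gamma.
have mt_step t k := @jacobi_moment_t_step R _ _ gamma halpha hbeta t k.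
have m1_step t k := @jacobi_moment_1_step R _ _ gamma halpha hbeta t k.
have pear t k := @jacobi_pearson R _ _ gamma halpha hbeta t k.
have dm t k := @derive_jacobi_moment R _ _ gamma halpha hbeta t k.
have dm1 t k := @derive_jacobi_moment_1 R _ _ gamma halpha hbeta t k.
have Pm (t : R) n : t < 0 -> P t n \is monic by move=> /hP[].
have Ps (t : R) n : t < 0 -> size (P t n) = n.+1 by move=> /hP[].
have h0 (t : R) n : t < 0 -> 0 < h n t by move=> /hP[].
have Po (t : R) i j : t < 0 ->
    moment_functional (m ^~ t) (P t i * P t j) = h i t * (i == j)%:R.
  move=> t0; have [_ _ _ ho] := hP _ t0.
  have -> : h i t * (i == j)%:R = h j t * (i == j)%:R.
    by case: eqP => [->//|_]; rewrite !mulr0.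
  rewrite -ho.
  rewrite [LHS](moment_functional_Rintegral _ (integrable_weight gamma halpha hbeta t0)).
  by apply: eq_Rintegral => x _; rewrite hornerM.
have RE n (t : R) : t < 0 -> Rn alpha beta gamma P h n t =
    moment_functional (m1 ^~ t) (P t n * P t n) / h n t.
  move=> t0; rewrite moment_functional_scale moment_functional_Rintegral;
    last exact: integrable_weight_onem.
  rewrite /Rn [RHS]mulrAC; congr (_ * _); apply: eq_Rintegral => x _.
  by rewrite hornerM -expr2 [RHS]mulrA.
split=> [[//|n] t _ t0|n t ka0 t0].
  have tn0 : t != 0 by rewrite lt_eqF.
  have d := derive_recurrence_coefficient mt_step m1_step pear dm Pm Ps h0 Po
    hrec n t0.
  split; first by case: d.
  by rewrite (derive1_val d) !RE // mulrC mulfVK.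
apply: (painleve6_of_orthogonality mt_step m1_step pear dm dm1 Pm Ps h0 Po hrec
  _ ka0 t0) => s s0.
by rewrite /Wn RE.
Qed.
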